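(* Let $1\to K\xrightarrow{\iota} G\to Q\to 1$ be an $\mathrm{abf}$-exact sequence of groups, with $Q$ torsion-free abelian. Then: (1) The map $\iota$ induces a $\mathbb{Z}[K_{\mathrm{abf}}]$-linear isomorphism $B_{\mathbb{Q}}(K)\to B_{\mathbb{Q}}(G)_{\iota}$. (2) If $G_{\mathrm{abf}}$ is finitely generated, then $\theta_n(K)\le\theta_n(G)$ for all $n\ge 1$. (3) If the sequence is split exact, then $\iota$ induces isomorphisms of graded Lie algebras $\mathrm{gr}^{\mathbb{Q}}_{\ge 2}(K)\xrightarrow{\simeq}\mathrm{gr}^{\mathbb{Q}}_{\ge 2}(G)$ and $\mathrm{gr}^{\mathbb{Q}}_{\ge 2}(K/K'')\xrightarrow{\simeq}\mathrm{gr}^{\mathbb{Q}}_{\ge 2}(G/G'')$. Consequently, if $b_1(G)<\infty$, then $\phi_n(K)=\phi_n(G)$ and $\theta_n(K)=\theta_n(G)$ for all $n\ge 2$.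
   Context: For a group $G$ and $S\subseteq G$, $\sqrt{S}=\{g\in G: g^m\in S\text{ for some }m>0\}$. $G'=[G,G]$, $G''=[G',G']$, $G'_{\mathbb{Q}}=\sqrt{G'}$, $G''_{\mathbb{Q}}=\sqrt{[G'_{\mathbb{Q}},G'_{\mathbb{Q}}]}$, $G_{\mathrm{ab}}=G/G'$, $G_{\mathrm{abf}}=G_{\mathrm{ab}}/\mathrm{Tors}(G_{\mathrm{ab}})=G/G'_{\mathbb{Q}}$. A short exact sequence of groups $1\to K\to G\to Q\to 1$ is $\mathrm{abf}$-exact if the induced sequence $0\to K_{\mathrm{abf}}\to G_{\mathrm{abf}}\to Q_{\mathrm{abf}}\to 0$ is exact. The rational Alexander invariant $B_{\mathbb{Q}}(G)=G'_{\mathbb{Q}}/G''_{\mathbb{Q}}$ is a $\mathbb{Z}[G_{\mathrm{abf}}]$-module via conjugation. A homomorphism $\iota\colon K\to G$ induces $B_{\mathbb{Q}}(K)\to B_{\mathbb{Q}}(G)$ and a ring map $\mathbb{Z}[K_{\mathrm{abf}}]\to\mathbb{Z}[G_{\mathrm{abf}}]$; $B_{\mathbb{Q}}(G)_\iota$ is $B_{\mathbb{Q}}(G)$ viewed as a $\mathbb{Z}[K_{\mathrm{abf}}]$-module by restriction of scalars. Lower central series: $\gamma_1(G)=G$, $\gamma_{n+1}(G)=[G,\gamma_n(G)]$, $\mathrm{gr}_n(G)=\gamma_n(G)/\gamma_{n+1}(G)$. Rational lower central series: $\gamma^{\mathbb{Q}}_1(G)=G$, $\gamma^{\mathbb{Q}}_{n+1}(G)=\sqrt{[G,\gamma^{\mathbb{Q}}_n(G)]}$;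 $\mathrm{gr}^{\mathbb{Q}}(G)=\bigoplus_{n\ge1}\gamma^{\mathbb{Q}}_n(G)/\gamma^{\mathbb{Q}}_{n+1}(G)$, a graded Lie algebra with bracket induced by the group commutator; $\mathrm{gr}^{\mathbb{Q}}_{\ge2}$ is its part in degrees $\ge2$. $b_1(G)=\dim_{\mathbb{Q}}H_1(G;\mathbb{Q})$; when it is finite, $\phi_n(G)=\dim_{\mathbb{Q}}\mathrm{gr}_n(G)\otimes\mathbb{Q}$ and $\theta_n(G)=\phi_n(G/G'')$ (Chen ranks). *)

(* Defs.v *)
From HB Require Import structures.
From mathcomp Require Import all_boot all_order all_algebra.
From mathcomp Require Import mathcomp_extra boolp classical_sets.
From mathcomp Require Import finmap monalg.

Set Implicit Arguments.
Unset Strict Implicit.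
Unset Printing Implicit Defensive.

Import GRing.Theory.

Local Open Scope classical_set_scope.
Local Open Scope quotient_scope.
Local Open Scope group_scope.

Notation groupHom := UMagmaMorphism.type.

Section Subgroups.
Variable G : groupType.
Implicit Types (A B N : set G) (x y g : G).

Definition is_subgroup A : Prop :=
  A 1 /\ (forall x y, A x -> A y -> A (x / y)).

Definition generated A : set G := smallest is_subgroup A.

Definition is_conj_stable A : Prop := forall x g, A x -> A (x ^ g).

(* The subgroup [A, B]. *)
Definition commS A B : set G :=
  generated [set z | exists x y, [/\ A x, B y & z = [~ x, y]]].

(* The set of roots of A, i.e. the elements with a positive power in A. *)
Definition isol A : set G := [set g | exists2 m, (0 < m)%N & A (g ^+ m)].

Lemma sgV A x : is_subgroup A -> A x -> A x^-1.
Proof. by case=> A1 AF Ax; rewrite -[x^-1]mul1g; apply: AF. Qed.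

Lemma sgM A x y : is_subgroup A -> A x -> A y -> A (x * y).
Proof. by move=> sA Ax Ay; rewrite -[y]invgK; apply: sA.2 => //; apply: sgV. Qed.

Lemma sgX A x n : is_subgroup A -> A x -> A (x ^+ n).
Proof.
move=> sA Ax; elim: n => [|n IH]; first by rewrite expg0; case: sA.
by rewrite expgS; apply: sgM.
Qed.

Lemma sgR A x y : is_subgroup A -> A x -> A y -> A [~ x, y].
Proof.
move=> sA Ax Ay; rewrite commgEl conjgE.
by do !apply: sgM => //; apply: sgV.
Qed.

Lemma setT_subgroup : is_subgroup [set: G].
Proof. by []. Qed.

Lemma generated_subgroup A : is_subgroup (generated A).
Proof.
split=> [|x y gx gy] B [sB AB]; first by case: sB.
by apply: sB.2; [apply: gx | apply: gy].
Qed.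

Lemma sub_generated A : A `<=` generated A.
Proof. by move=> x Ax B [_]; apply. Qed.

Lemma generated_min A B : is_subgroup B -> A `<=` B -> generated A `<=` B.
Proof. by move=> sB AB x gx; apply: gx. Qed.

Lemma conj_preim_subgroup A g : is_subgroup A -> is_subgroup [set x | A (x ^ g)].
Proof.
move=> sA; split=> [|x y] /=; first by rewrite conj1g; case: sA.
by rewrite conjMg conjVg => Ax Ay; apply: sA.2.
Qed.

Lemma generated_conj A : is_conj_stable A -> is_conj_stable (generated A).
Proof.
move=> cA x g; move: x; apply: (@generated_min _ [set x | generated A (x ^ g)]).
  exact/conj_preim_subgroup/generated_subgroup.
by move=> x Ax; apply: sub_generated; apply: cA.
Qed.

Lemma commS_subgroup A B : is_subgroup (commS A B).
Proof. exact: generated_subgroup. Qed.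

Lemma commS_conj A B :
  is_conj_stable A -> is_conj_stable B -> is_conj_stable (commS A B).
Proof.
move=> cA cB; apply: generated_conj => _ g [x [y [Ax By ->]]].
by exists (x ^ g), (y ^ g); split; [exact: cA|exact: cB|rewrite conjRg].
Qed.

Lemma mem_commS A B x y : A x -> B y -> commS A B [~ x, y].
Proof. by move=> Ax By; apply: sub_generated; exists x, y. Qed.

Lemma conj_commR A x g : is_subgroup A -> is_conj_stable A -> A x -> A [~ x, g].
Proof. by move=> sA cA Ax; rewrite commgEl; apply: sgM; [|exact: sgV|exact: cA]. Qed.

Lemma conj_commL A x g : is_subgroup A -> is_conj_stable A -> A x -> A [~ g, x].
Proof. by move=> sA cA Ax; rewrite -invgR; apply: sgV => //; apply: conj_commR. Qed.

Lemma commS_subl A B : is_subgroup A -> is_conj_stable A -> commS A B `<=` A.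
Proof.
move=> sA cA; apply: generated_min => // _ [x [y [Ax _ ->]]].
exact: conj_commR.
Qed.

Lemma commS_subr A B : is_subgroup B -> is_conj_stable B -> commS A B `<=` B.
Proof.
move=> sB cB; apply: generated_min => // _ [x [y [_ By ->]]].
exact: conj_commL.
Qed.

Lemma sub_isol A : A `<=` isol A.
Proof. by move=> x Ax; exists 1%N. Qed.

Lemma isolS A B : A `<=` B -> isol A `<=` isol B.
Proof. by move=> AB x [m m0 Am]; exists m => //; apply: AB. Qed.

Lemma isol_idem A : isol (isol A) `<=` isol A.
Proof.
by move=> x [m m0 [n n0]]; rewrite -expgnA => Am; exists (m * n)%N; rewrite ?muln_gt0 ?m0.
Qed.

Lemma isol_conj A : is_conj_stable A -> is_conj_stable (isol A).
Proof. by move=> cA x g [m m0 Am]; exists m => //; rewrite -conjXg; apply: cA. Qed.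

End Subgroups.

(* The abelian quotient A/B of subgroups B <= A of G with [A, A] <= B, written
   additively. *)
Record absect (G : groupType) := AbSect {
  numer : set G;
  denom : set G;
  numer_subgroup : is_subgroup numer;
  denom_subgroup : is_subgroup denom;
  denom_numer : denom `<=` numer;
  numer_comm : forall x y, numer x -> numer y -> denom [~ x, y] }.

Section AbSection.
Variables (G : groupType) (S : absect G).
Implicit Types (x y z g : G).

Definition sect_carrier := {x : G | x \in numer S}.
HB.instance Definition _ := Choice.on sect_carrier.

Definition sect_rel (u v : sect_carrier) : bool := `[< denom S (val u / val v) >].

Let sN := numer_subgroup S.
Let sD := denom_subgroup S.

Lemma sect_rel_equiv : equiv_class_of sect_rel.
Proof.
split=> [x|x y|y x z].
- by apply/asboolP; rewrite mulgV; case: sD.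
- by apply/asboolP/asboolP => /(sgV sD); rewrite invgF.
- move=> /asboolP xy /asboolP yz; apply/asboolP.
  by have := sgM sD xy yz; rewrite mulgA mulgVK.
Qed.

Canonical sect_equiv := EquivRelPack sect_rel_equiv.

Definition sect : Type := {eq_quot sect_rel}.
HB.instance Definition _ : EqQuotient sect_carrier sect_rel sect := EqQuotient.on sect.
HB.instance Definition _ := Choice.on sect.

Definition sect1 : sect_carrier := Sub 1 (mem_set sN.1).

(* The class of x, for x in the numerator (and 0 for the other elements). *)
Definition sclass x : sect := \pi_sect (insubd sect1 x).

Definition srepr (u : sect) : G := val (repr u).

Lemma srepr_numer u : numer S (srepr u).
Proof. exact: (set_mem (valP (repr u))). Qed.

Lemma sreprK : cancel srepr sclass.
Proof. by move=> u; rewrite /sclass /srepr valKd reprK. Qed.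

Lemma sclass_eqP x y : numer S x -> numer S y ->
  sclass x = sclass y <-> denom S (x / y).
Proof.
move=> Nx Ny; rewrite /sclass; split.
  move/eqmodP/asboolP; rewrite /= !val_insubd.
  by rewrite !ifT; try exact: mem_set.
move=> Dxy; apply/eqmodP/asboolP; rewrite /= !val_insubd.
by rewrite !ifT; try exact: mem_set.
Qed.

Lemma srepr_class x : numer S x -> denom S (srepr (sclass x) / x).
Proof. by move=> Nx; apply/sclass_eqP; rewrite ?sreprK //; apply: srepr_numer. Qed.

Lemma denom_conj x d : numer S x -> denom S d -> denom S (d ^ x).
Proof.
move=> Nx Dd; rewrite -[d ^ x](mulVKg d) -commgEl.
by apply: sgM => //; apply: numer_comm => //; apply: denom_numer.
Qed.

Lemma denomC x y : numer S x -> numer S y -> denom S (x * y) -> denom S (y * x).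
Proof.
move=> Nx Ny /(denom_conj Nx); rewrite conjgE -!mulgA mulKg; exact.
Qed.

Definition sect_add u v := sclass (srepr u * srepr v).
Definition sect_opp u := sclass (srepr u)^-1.

Lemma sect_addE x y : numer S x -> numer S y ->
  sect_add (sclass x) (sclass y) = sclass (x * y).
Proof.
move=> Nx Ny; have [Nx' Ny'] := (srepr_numer (sclass x), srepr_numer (sclass y)).
apply/sclass_eqP; [exact: sgM|exact: sgM|].
rewrite invgM mulgA -(mulgA (srepr _)).
have /(denom_conj (sgV sN Nx')) := srepr_class Ny.
rewrite conjgE invgK => D1.
have := sgM sD D1 (srepr_class Nx).
by rewrite -!mulgA mulKg !mulgA.
Qed.

Lemma sect_oppE x : numer S x -> sect_opp (sclass x) = sclass x^-1.
Proof.
move=> Nx; have Nx' := srepr_numer (sclass x).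
apply/sclass_eqP; [exact: sgV|exact: sgV|].
rewrite invgK.
have /(sgV sD) := srepr_class Nx; rewrite invgF.
exact: denomC (sgV sN _).
Qed.

Fact sect_addA : associative sect_add.
Proof.
move=> u v w; rewrite -[u]sreprK -[v]sreprK -[w]sreprK.
by rewrite !sect_addE ?mulgA //; do ?apply: sgM => //; exact: srepr_numer.
Qed.

Fact sect_addC : commutative sect_add.
Proof.
move=> u v; rewrite -[u]sreprK -[v]sreprK.
have [Nu Nv] := (srepr_numer u, srepr_numer v).
rewrite !sect_addE //; apply/sclass_eqP; [exact: sgM|exact: sgM|].
have := numer_comm (sgV sN Nu) (sgV sN Nv).
by rewrite commgEl conjgE !invgK invgM !mulgA.
Qed.

Fact sect_add0 : left_id (sclass 1) sect_add.
Proof.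
by move=> u; rewrite -[u]sreprK sect_addE ?mul1g //; [case: sN|exact: srepr_numer].
Qed.

Fact sect_addN : left_inverse (sclass 1) sect_opp sect_add.
Proof.
move=> u; rewrite -[u]sreprK; have Nu := srepr_numer u.
by rewrite sect_oppE // sect_addE ?mulVg //; apply: sgV.
Qed.

HB.instance Definition _ :=
  GRing.isZmodule.Build sect sect_addA sect_addC sect_add0 sect_addN.

Lemma sclassM x y : numer S x -> numer S y ->
  sclass (x * y) = (sclass x + sclass y)%R.
Proof. by move=> Nx Ny; rewrite -sect_addE. Qed.

Lemma sclassV x : numer S x -> sclass x^-1 = (- sclass x)%R.
Proof. by move=> Nx; rewrite -sect_oppE. Qed.

Lemma sclass1 : sclass 1 = 0%R. Proof. by []. Qed.

Lemma sclassX x n : numer S x -> sclass (x ^+ n) = (sclass x *+ n)%R.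
Proof.
move=> Nx; elim: n => [|n IH]; first by rewrite expg0 mulr0n.
by rewrite expgS sclassM ?IH ?mulrS //; apply: sgX.
Qed.

Lemma sclass0P x : numer S x -> sclass x = 0%R <-> denom S x.
Proof. by move=> Nx; rewrite -sclass1 sclass_eqP ?invg1 ?mulg1 //; case: sN. Qed.

End AbSection.

Section IsolSubgroup.
Variables (G : groupType) (A B : set G).
Hypotheses (sA : is_subgroup A) (sB : is_subgroup B) (iBA : isol B `<=` A).
Hypothesis (cAB : forall x y, A x -> A y -> B [~ x, y]).

Lemma isol_subgroup : is_subgroup (isol B).
Proof.
pose S := AbSect sA sB (fun x Bx => iBA (sub_isol Bx)) cAB.
split=> [|x y Ix Iy]; first by apply: sub_isol; case: sB.
have [Ax Ay] := (iBA Ix, iBA Iy).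
case: Ix Iy => m m0 Bx [n n0 By].
have AxV := sgV sA Ay.
exists (m * n)%N; first by rewrite muln_gt0 m0.
apply/(sclass0P (S := S)); first by apply: (sgX _ sA); apply: sgM.
have sx : (sclass S x *+ m = 0)%R by rewrite -sclassX //; apply/(sclass0P (S := S)) => //; apply: (sgX _ sA).
have sy : (sclass S y *+ n = 0)%R by rewrite -sclassX //; apply/(sclass0P (S := S)) => //; apply: (sgX _ sA).
rewrite (sclassX (S := S)) ?sclassM ?sclassV //; last exact: sgM.
by rewrite mulrnDl mulrnA sx mul0rn add0r mulNrn mulnC mulrnA sy mul0rn oppr0.
Qed.

End IsolSubgroup.

Record nsubgroup (G : groupType) := NSubgroup {
  nset : set G;
  nset_subgroup : is_subgroup nset;
  nset_conj : is_conj_stable nset }.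

Section QuotientGroup.
Variables (G : groupType) (N : nsubgroup G).
Implicit Types x y : G.

Definition quotg_rel x y : bool := `[< nset N (x / y) >].

Let sN := nset_subgroup N.

Lemma quotg_rel_equiv : equiv_class_of quotg_rel.
Proof.
split=> [x|x y|y x z].
- by apply/asboolP; rewrite mulgV; case: sN.
- by apply/asboolP/asboolP => /(sgV sN); rewrite invgF.
- move=> /asboolP xy /asboolP yz; apply/asboolP.
  by have := sgM sN xy yz; rewrite mulgA mulgVK.
Qed.

Canonical quotg_equiv := EquivRelPack quotg_rel_equiv.
Canonical quotg_encModRel := defaultEncModRel quotg_rel.

Definition quotg : Type := {eq_quot quotg_rel}.
HB.instance Definition _ : EqQuotient G quotg_rel quotg := EqQuotient.on quotg.
HB.instance Definition _ := Choice.on quotg.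

Definition qclass x : quotg := \pi_quotg x.

Lemma qclass_eqP x y : qclass x = qclass y <-> nset N (x / y).
Proof. by split=> [/eqmodP/asboolP|Nxy] //; apply/eqmodP/asboolP. Qed.

Lemma qclassK : cancel (fun u : quotg => repr u) qclass.
Proof. exact: reprK. Qed.

Lemma repr_qclass x : nset N (repr (qclass x) / x).
Proof. by apply/qclass_eqP; rewrite qclassK. Qed.

Definition quotg_mul (u v : quotg) := qclass (repr u * repr v).
Definition quotg_inv (u : quotg) := qclass (repr u)^-1.

Lemma quotg_mulE x y : quotg_mul (qclass x) (qclass y) = qclass (x * y).
Proof.
apply/qclass_eqP; rewrite invgM mulgA -(mulgA (repr _)).
have /(nset_conj (repr (qclass x))^-1) := repr_qclass y.
rewrite conjgE invgK => D1.
have := sgM sN D1 (repr_qclass x).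
by rewrite -!mulgA mulKg !mulgA.
Qed.

Lemma quotg_invE x : quotg_inv (qclass x) = qclass x^-1.
Proof.
apply/qclass_eqP; rewrite invgK.
have /(sgV sN)/(nset_conj x) := repr_qclass x.
by rewrite invgF conjgE -!mulgA mulKg.
Qed.

Fact quotg_mulA : associative quotg_mul.
Proof.
by move=> u v w; rewrite -[u]qclassK -[v]qclassK -[w]qclassK !quotg_mulE mulgA.
Qed.

Fact quotg_mul1 : left_id (qclass 1) quotg_mul.
Proof. by move=> u; rewrite -[u]qclassK quotg_mulE mul1g. Qed.

Fact quotg_mulr1 : right_id (qclass 1) quotg_mul.
Proof. by move=> u; rewrite -[u]qclassK quotg_mulE mulg1. Qed.

Fact quotg_mulV : left_inverse (qclass 1) quotg_inv quotg_mul.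
Proof. by move=> u; rewrite -[u]qclassK quotg_invE quotg_mulE mulVg. Qed.

Fact quotg_mulrV : right_inverse (qclass 1) quotg_inv quotg_mul.
Proof. by move=> u; rewrite -[u]qclassK quotg_invE quotg_mulE mulgV. Qed.

HB.instance Definition _ := isGroup.Build quotg
  quotg_mulA quotg_mul1 quotg_mulr1 quotg_mulV quotg_mulrV.

Fact qclass_morphism : {morph qclass : x y / x / y}.
Proof. by move=> x y; rewrite -quotg_mulE -quotg_invE. Qed.

HB.instance Definition _ := isGroupMorphism.Build G quotg qclass qclass_morphism.

End QuotientGroup.

Section QuotientMap.
Variables (G H : groupType) (M : nsubgroup G) (N : nsubgroup H).
Variables (f : groupHom G H) (fMN : forall x, nset M x -> nset N (f x)).

(* The proof that f maps M into N is an argument only to make the map a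
   homomorphism. *)
Definition quotg_map of (forall x, nset M x -> nset N (f x)) :=
  fun u : quotg M => qclass N (f (repr u)).

Lemma quotg_mapE x : quotg_map fMN (qclass M x) = qclass N (f x).
Proof.
by apply/qclass_eqP; have /fMN := repr_qclass M x; rewrite gmulfF.
Qed.

Fact quotg_map_morphism : {morph quotg_map fMN : x y / x / y}.
Proof.
move=> u v; rewrite -[u]qclassK -[v]qclassK -gmulfF !quotg_mapE.
by rewrite gmulfF [LHS]gmulfF.
Qed.

HB.instance Definition _ := isGroupMorphism.Build (quotg M) (quotg N)
  (quotg_map fMN) quotg_map_morphism.

End QuotientMap.

Section Derived.
Variable G : groupType.

(* G', G'', G'_Q and G''_Q. *)
Definition derived1 : set G := commS [set: G] [set: G].
Definition derived2 : set G := commS derived1 derived1.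
Definition derivedQ1 : set G := isol derived1.
Definition derivedQ2 : set G := isol (commS derivedQ1 derivedQ1).

Lemma setT_conj : is_conj_stable [set: G]. Proof. by []. Qed.

Lemma derived1_conj : is_conj_stable derived1.
Proof. exact: commS_conj. Qed.

Lemma derived2_conj : is_conj_stable derived2.
Proof. exact: commS_conj derived1_conj derived1_conj. Qed.

Lemma derivedQ1_subgroup : is_subgroup derivedQ1.
Proof.
apply: (@isol_subgroup _ [set: G]) => //; first exact: commS_subgroup.
by move=> x y _ _; apply: mem_commS.
Qed.

Lemma derivedQ1_conj : is_conj_stable derivedQ1.
Proof. exact: isol_conj derived1_conj. Qed.

Lemma derivedQ2_sub : derivedQ2 `<=` derivedQ1.
Proof.
move=> x Dx; apply: isol_idem; move: x Dx; apply: isolS.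
exact: commS_subl derivedQ1_subgroup derivedQ1_conj.
Qed.

Lemma derivedQ2_subgroup : is_subgroup derivedQ2.
Proof.
apply: (@isol_subgroup _ derivedQ1).
- exact: derivedQ1_subgroup.
- exact: commS_subgroup.
- exact: derivedQ2_sub.
- exact: mem_commS.
Qed.

Lemma derivedQ2_conj : is_conj_stable derivedQ2.
Proof. exact: isol_conj (commS_conj derivedQ1_conj derivedQ1_conj). Qed.

Lemma derivedQ2_comm x y : derivedQ1 x -> derivedQ1 y -> derivedQ2 [~ x, y].
Proof. by move=> Dx Dy; apply: sub_isol; apply: mem_commS. Qed.

Definition derived2_normal : nsubgroup G :=
  NSubgroup (commS_subgroup derived1 derived1) derived2_conj.

Definition derivedQ1_normal : nsubgroup G :=
  NSubgroup derivedQ1_subgroup derivedQ1_conj.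

(* G_abf = G / G'_Q. *)
Definition abf := quotg derivedQ1_normal.
HB.instance Definition _ := Group.on abf.

(* G / G''. *)
Definition metab := quotg derived2_normal.
HB.instance Definition _ := Group.on metab.

Definition BQ_sect : absect G :=
  AbSect derivedQ1_subgroup derivedQ2_subgroup derivedQ2_sub derivedQ2_comm.

End Derived.

Arguments derived1 : clear implicits.
Arguments derived2 : clear implicits.
Arguments derivedQ1 : clear implicits.
Arguments derivedQ2 : clear implicits.

Section Functoriality.
Variables (G H : groupType) (f : groupHom G H).

Lemma commS_hom (A B : set G) (A' B' : set H) :
    (forall x, A x -> A' (f x)) -> (forall x, B x -> B' (f x)) ->
  forall x, commS A B x -> commS A' B' (f x).
Proof.
move=> AA BB; apply: (@generated_min _ _ [set x | commS A' B' (f x)]).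
  have [s1 sF] := commS_subgroup A' B'.
  by split=> [|x y] /=; rewrite ?gmulf1 // gmulfF; apply: sF.
by move=> _ [x [y [Ax By ->]]] /=; rewrite gmulfR; apply: mem_commS; auto.
Qed.

Lemma isol_hom (A : set G) (B : set H) :
  (forall x, A x -> B (f x)) -> forall x, isol A x -> isol B (f x).
Proof. by move=> AB x [m m0 Am]; exists m => //; rewrite -gmulfXn; apply: AB. Qed.

Lemma derivedQ1_hom x : nset (derivedQ1_normal G) x -> nset (derivedQ1_normal H) (f x).
Proof. by apply: isol_hom; apply: commS_hom. Qed.

Lemma derived2_hom x : nset (derived2_normal G) x -> nset (derived2_normal H) (f x).
Proof. by apply: commS_hom; apply: commS_hom. Qed.

Definition abf_map : groupHom (abf G) (abf H) := quotg_map derivedQ1_hom.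
Definition metab_map : groupHom (metab G) (metab H) := quotg_map derived2_hom.

End Functoriality.

Section LowerCentralSeries.
Variable G : groupType.

(* The value at 0 is a placeholder, equal to the value at 1. *)
Fixpoint gamma (n : nat) : set G :=
  if n is m.+1 then (if m is 0 then [set: G] else commS [set: G] (gamma m))
  else [set: G].

Fixpoint gammaQ (n : nat) : set G :=
  if n is m.+1 then
    (if m is 0 then [set: G] else isol (commS [set: G] (gammaQ m)))
  else [set: G].

Lemma gammaSS n : gamma n.+2 = commS [set: G] (gamma n.+1). Proof. by []. Qed.

Lemma gammaQSS n : gammaQ n.+2 = isol (commS [set: G] (gammaQ n.+1)).
Proof. by []. Qed.

Lemma gamma_subgroup n : is_subgroup (gamma n).
Proof. by case: n => [|[|n]] //; exact: commS_subgroup. Qed.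

Lemma gamma_conj n : is_conj_stable (gamma n).
Proof. by elim: n => [|[|n] IH] //; exact: commS_conj. Qed.

Lemma gamma_sub n : gamma n.+1 `<=` gamma n.
Proof.
by case: n => [|n] //; rewrite gammaSS; apply: commS_subr; [exact: gamma_subgroup|exact: gamma_conj].
Qed.

Lemma gamma_comm n x y : gamma n x -> gamma n y -> gamma n.+1 [~ x, y].
Proof. by case: n => [|n] // _ Gy; apply: mem_commS. Qed.

Lemma gammaQ_conj n : is_conj_stable (gammaQ n).
Proof. by elim: n => [|[|n] IH] //; apply: isol_conj; apply: commS_conj. Qed.

Lemma gammaQ_isol n : isol (gammaQ n) `<=` gammaQ n.
Proof. by case: n => [|[|n]] //; exact: isol_idem. Qed.

Lemma gammaQ_sub_subgroup n : is_subgroup (gammaQ n) /\ gammaQ n.+1 `<=` gammaQ n.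
Proof.
elim: n => [|n [sn IH]]; first by [].
have sn1 : is_subgroup (gammaQ n.+1).
  case: n sn IH => [|n] sn IH //; rewrite gammaQSS.
  apply: (isol_subgroup sn) => //; first exact: commS_subgroup.
  by move=> x y _ Gy; apply: mem_commS.
split=> // x; rewrite gammaQSS => Ix; apply: gammaQ_isol; move: x Ix.
apply: isolS; apply: commS_subr => //; exact: gammaQ_conj.
Qed.

Lemma gammaQ_subgroup n : is_subgroup (gammaQ n).
Proof. by case: (gammaQ_sub_subgroup n). Qed.

Lemma gammaQ_sub n : gammaQ n.+1 `<=` gammaQ n.
Proof. by case: (gammaQ_sub_subgroup n). Qed.

Lemma gammaQ_commT n x y : gammaQ n y -> gammaQ n.+1 [~ x, y].
Proof. by case: n => [|n] // Gy; rewrite gammaQSS; apply: sub_isol; apply: mem_commS. Qed.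

Lemma gammaQ_comm1 n x y : gammaQ n x -> gammaQ n y -> gammaQ n.+1 [~ x, y].
Proof. by move=> _; apply: gammaQ_commT. Qed.

Definition gr_sect n : absect G :=
  AbSect (gamma_subgroup n) (gamma_subgroup n.+1) (@gamma_sub n) (@gamma_comm n).

Definition grQ_sect n : absect G :=
  AbSect (gammaQ_subgroup n) (gammaQ_subgroup n.+1) (@gammaQ_sub n) (@gammaQ_comm1 n).

Lemma commMg (x y z : G) : [~ x * y, z] = [~ x, z] ^ y * [~ y, z].
Proof. by rewrite /commg /conjg !invgM !mulgA !(mulgK, mulgVK). Qed.

Lemma commgM (x y z : G) : [~ x, y * z] = [~ x, z] * [~ x, y] ^ z.
Proof. by rewrite /commg /conjg !invgM !mulgA !(mulgK, mulgVK). Qed.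

Lemma commVg (x y : G) : [~ x^-1, y] = ([~ x, y] ^ x^-1)^-1.
Proof. by rewrite /commg /conjg !invgM !invgK !mulgA !(mulgV, mul1g, mulgK, mulgVK). Qed.

Lemma hall_witt (x y z : G) :
  [~ x, y^-1, z] ^ y * [~ y, z^-1, x] ^ z * [~ z, x^-1, y] ^ x = 1.
Proof.
by rewrite /commg /conjg !(invgM, invgK) !mulgA !(mulgV, mulVg, mul1g, mulgK, mulgVK).
Qed.

Let gsQ := gammaQ_subgroup.

Lemma class_conj n c z : gammaQ n c -> sclass (grQ_sect n) (c ^ z) = sclass _ c.
Proof.
move=> Gc; rewrite -[c ^ z](mulVKg c) -commgEl.
have Gr : gammaQ n.+1 [~ c, z] by rewrite -invgR; apply: sgV => //; apply: gammaQ_commT.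
rewrite sclassM //; last by apply: gammaQ_sub.
by rewrite [X in (_ + X)%R]((sclass0P (S := grQ_sect n) _).2) ?addr0 //; apply: gammaQ_sub.
Qed.

Lemma gammaQ_comm m n x y : gammaQ m x -> gammaQ n y -> gammaQ (m + n) [~ x, y].
Proof.
elim: m n x y => [|m IH] n x y; first by move=> _; apply: conj_commL => //; exact: gammaQ_conj.
case: m IH => [|m] IH; first by move=> _; apply: gammaQ_commT.
rewrite gammaQSS => -[k k0 Cx] Gy.
have Gx : gammaQ m.+1 x.
  by apply: gammaQ_sub; rewrite gammaQSS; exists k.
have cN := @gammaQ_conj (m.+2 + n).
have Cxy : gammaQ (m.+2 + n) [~ x ^+ k, y].
  move: (x ^+ k) Cx => {k k0 Gx}.
  apply: (@generated_min _ _ [set w | gammaQ (m.+2 + n) [~ w, y]]).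
    split=> [|u v]; rewrite /mkset; first by rewrite comm1g; case: (gsQ (m.+2 + n)).
    move=> Cu Cv; rewrite commMg commVg.
    by apply: sgM => //; [exact: cN | apply: sgV => //; exact: cN].
  move=> _ [g [a [_ Ga ->]]]; rewrite /mkset.
  have := hall_witt g a^-1 y; rewrite invgK => /eqP.
  rewrite -mulgA mulg_eq1 => /eqP E.
  rewrite -[X in gammaQ _ X](conjgK a^-1) E; apply: (cN); apply: sgV => //.
  apply: sgM => //; apply: (cN); rewrite -invgR; apply: sgV => //.
    rewrite addSn; apply: gammaQ_commT; apply: IH; apply: sgV => //.
  rewrite addSnnS; apply: IH; first exact: sgV.
  by rewrite -invgR; apply: sgV => //; apply: gammaQ_commT.
have Gxy := IH _ _ _ Gx Gy.
suff : sclass (grQ_sect (m.+1 + n)) ([~ x, y] ^+ k) = 0%R.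
  move/(sclass0P (S := grQ_sect (m.+1 + n)) (sgX _ (gsQ _) Gxy)) => Gk.
  by apply: gammaQ_isol; exists k.
have <- : sclass (grQ_sect (m.+1 + n)) [~ x ^+ k, y] = 0%R.
  by apply/sclass0P => //; apply: gammaQ_sub.
rewrite sclassX //; elim: k {k0 Cx Cxy} => [|k IHk]; first by rewrite expg0 comm1g mulr0n.
have Gk : gammaQ (m.+1 + n) [~ x ^+ k, y] by apply: IH => //; apply: (sgX _ (gsQ _)).
rewrite expgS commMg [RHS]sclassM //; last exact: (gammaQ_conj _ Gxy).
by rewrite class_conj // mulrS IHk.
Qed.

End LowerCentralSeries.

Arguments gamma : clear implicits.
Arguments gammaQ : clear implicits.

(* A Lie algebra over the integers graded by nat, given by its homogeneous
   components; the bracket of degrees m and n is indexed by any k equal to m + n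
   so that the axioms typecheck without casts. *)
Record gradedLie := GradedLie {
  gl_comp :> nat -> zmodType;
  gl_br : forall m n k, (m + n)%N = k -> gl_comp m -> gl_comp n -> gl_comp k;
  gl_brDl : forall m n k (e : (m + n)%N = k) x x' y,
    gl_br e (x + x')%R y = (gl_br e x y + gl_br e x' y)%R;
  gl_brDr : forall m n k (e : (m + n)%N = k) x y y',
    gl_br e x (y + y')%R = (gl_br e x y + gl_br e x y')%R;
  gl_brxx : forall m k (e : (m + m)%N = k) x, gl_br e x x = 0%R;
  gl_brC : forall m n k (e : (m + n)%N = k) (e' : (n + m)%N = k) x y,
    gl_br e x y = (- gl_br e' y x)%R;
  gl_jacobi : forall m n p mn np pm k
      (emn : (m + n)%N = mn) (enp : (n + p)%N = np) (epm : (p + m)%N = pm)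
      (e1 : (mn + p)%N = k) (e2 : (np + m)%N = k) (e3 : (pm + n)%N = k) x y z,
    (gl_br e1 (gl_br emn x y) z + gl_br e2 (gl_br enp y z) x
      + gl_br e3 (gl_br epm z x) y = 0)%R }.

(* F restricts to an isomorphism between the parts of L and M of degrees >= d. *)
Definition gl_iso_from (d : nat) (L M : gradedLie) (F : forall n, L n -> M n) :=
  (forall n, (d <= n)%N ->
     {morph F n : x y / (x + y)%R} /\ bijective (F n)) /\
  (forall m n k (e : (m + n)%N = k) (x : L m) (y : L n),
     (d <= m)%N -> (d <= n)%N -> F k (gl_br e x y) = gl_br e (F m x) (F n y)).

Section GradedLieOfGroup.
Variable G : groupType.

Let gsQ := @gammaQ_subgroup G.
Let cQ := @gammaQ_conj G.

Definition grQ_comp (n : nat) : zmodType := sect (grQ_sect G n).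

Definition grQ_br m n k of (m + n)%N = k :=
  fun (u : grQ_comp m) (v : grQ_comp n) =>
    sclass (grQ_sect G k) [~ srepr u, srepr v].

Local Notation cl n := (sclass (grQ_sect G n)).

Lemma cl0 n x : gammaQ G n.+1 x -> cl n x = 0%R.
Proof. by move=> Gx; apply/sclass0P => //; apply: gammaQ_sub. Qed.

Lemma cl_commMl m n x x' y : gammaQ G m x -> gammaQ G m x' -> gammaQ G n y ->
  cl (m + n) [~ x * x', y] = (cl (m + n) [~ x, y] + cl (m + n) [~ x', y])%R.
Proof.
move=> Gx Gx' Gy; rewrite commMg sclassM ?class_conj //; try exact: gammaQ_comm.
by apply: cQ; apply: gammaQ_comm.
Qed.

Lemma cl_commMr m n x y y' : gammaQ G m x -> gammaQ G n y -> gammaQ G n y' ->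
  cl (m + n) [~ x, y * y'] = (cl (m + n) [~ x, y] + cl (m + n) [~ x, y'])%R.
Proof.
move=> Gx Gy Gy'; rewrite commgM addrC sclassM ?class_conj //; try exact: gammaQ_comm.
by apply: cQ; apply: gammaQ_comm.
Qed.

Lemma cl_commV m n x y : gammaQ G m x -> gammaQ G n y ->
  cl (m + n) [~ x, y^-1] = (- cl (m + n) [~ x, y])%R.
Proof.
move=> Gx Gy; apply/eqP; rewrite -addr_eq0 -cl_commMr //; last exact: sgV.
by rewrite mulVg commg1 sclass1.
Qed.

Lemma cl_commC k x y : gammaQ G k [~ y, x] -> cl k [~ x, y] = (- cl k [~ y, x])%R.
Proof. by move=> Gyx; rewrite -invgR sclassV. Qed.

Lemma grQ_brE m n k (e : (m + n)%N = k) x y : gammaQ G m x -> gammaQ G n y ->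
  grQ_br e (cl m x) (cl n y) = cl k [~ x, y].
Proof.
case: k / e => Gx Gy; rewrite /grQ_br.
set x' := srepr _; set y' := srepr _.
have Gx' : gammaQ G m x' := srepr_numer _.
have Gy' : gammaQ G n y' := srepr_numer _.
have Dx : gammaQ G m.+1 (x' / x) := srepr_class (S := grQ_sect G m) Gx.
have Dy : gammaQ G n.+1 (y' / y) := srepr_class (S := grQ_sect G n) Gy.
rewrite -[x'](mulgVK x) cl_commMl //; last exact: gammaQ_sub.
rewrite [X in (X + _)%R]cl0 ?add0r; last by rewrite -addSn; apply: gammaQ_comm.
rewrite -[y'](mulgVK y) cl_commMr //; last exact: gammaQ_sub.
by rewrite [X in (X + _)%R]cl0 ?add0r // -addnS; apply: gammaQ_comm.
Qed.

Lemma grQP n (u : grQ_comp n) : exists2 x, gammaQ G n x & u = cl n x.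
Proof. by exists (srepr u); [exact: srepr_numer|rewrite sreprK]. Qed.

Lemma grQ_brDl m n k (e : (m + n)%N = k) x x' y :
  grQ_br e (x + x')%R y = (grQ_br e x y + grQ_br e x' y)%R.
Proof.
have [a Ga ->] := grQP x; have [a' Ga' ->] := grQP x'; have [b Gb ->] := grQP y.
rewrite -sclassM // !grQ_brE //; last exact: sgM.
by case: k / e; rewrite cl_commMl.
Qed.

Lemma grQ_brDr m n k (e : (m + n)%N = k) x y y' :
  grQ_br e x (y + y')%R = (grQ_br e x y + grQ_br e x y')%R.
Proof.
have [a Ga ->] := grQP x; have [b Gb ->] := grQP y; have [b' Gb' ->] := grQP y'.
rewrite -sclassM // !grQ_brE //; last exact: sgM.
by case: k / e; rewrite cl_commMr.
Qed.

Lemma grQ_brxx m k (e : (m + m)%N = k) x : grQ_br e x x = 0%R.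
Proof. by rewrite /grQ_br commgg sclass1. Qed.

Lemma grQ_brC m n k (e : (m + n)%N = k) (e' : (n + m)%N = k) x y :
  grQ_br e x y = (- grQ_br e' y x)%R.
Proof.
have [a Ga ->] := grQP x; have [b Gb ->] := grQP y.
by rewrite !grQ_brE // cl_commC // -e'; apply: gammaQ_comm.
Qed.

Lemma cl_jacobi_term m n p x y z :
    gammaQ G m x -> gammaQ G n y -> gammaQ G p z ->
  cl (m + n + p) ([~ x, y^-1, z] ^ y) = (- cl (m + n + p) [~ x, y, z])%R.
Proof.
move=> Gx Gy Gz; have Gy' := sgV (gsQ n) Gy.
rewrite class_conj; last by do !apply: gammaQ_comm.
have brE a : gammaQ G (m + n) a ->
  cl (m + n + p) [~ a, z] = grQ_br erefl (cl (m + n) a) (cl p z).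
  by move=> Ga; rewrite grQ_brE.
have Gxy := gammaQ_comm Gx Gy; have Gxy' := gammaQ_comm Gx Gy'.
rewrite !brE // cl_commV //.
apply/eqP; rewrite -addr_eq0 -grQ_brDl addNr.
have ->: (0 = cl (m + n) 1)%R by [].
rewrite grQ_brE // ?comm1g //; by case: (gsQ (m + n)).
Qed.

Lemma grQ_jacobi m n p mn np pm k
      (emn : (m + n)%N = mn) (enp : (n + p)%N = np) (epm : (p + m)%N = pm)
      (e1 : (mn + p)%N = k) (e2 : (np + m)%N = k) (e3 : (pm + n)%N = k) x y z :
    (grQ_br e1 (grQ_br emn x y) z + grQ_br e2 (grQ_br enp y z) x
      + grQ_br e3 (grQ_br epm z x) y = 0)%R.
Proof.
have [a Ga ->] := grQP x; have [b Gb ->] := grQP y; have [c Gc ->] := grQP z.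
case: mn / emn e1 => e1; case: np / enp e2 => e2; case: pm / epm e3 => e3.
rewrite !grQ_brE //; try exact: gammaQ_comm.
have G1 : gammaQ G k [~ a, b, c] by rewrite -e1; do !apply: gammaQ_comm.
have G2 : gammaQ G k [~ b, c, a] by rewrite -e2; do !apply: gammaQ_comm.
have G3 : gammaQ G k [~ c, a, b] by rewrite -e3; do !apply: gammaQ_comm.
have N1 : gammaQ G k ([~ a, b^-1, c] ^ b).
  by apply: cQ; rewrite -e1; do !apply: gammaQ_comm => //; exact: sgV.
have N2 : gammaQ G k ([~ b, c^-1, a] ^ c).
  by apply: cQ; rewrite -e2; do !apply: gammaQ_comm => //; exact: sgV.
have N3 : gammaQ G k ([~ c, a^-1, b] ^ a).
  by apply: cQ; rewrite -e3; do !apply: gammaQ_comm => //; exact: sgV.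
have /(congr1 (cl k)) := hall_witt a b c.
rewrite (sclassM (S := grQ_sect G k) (sgM (gsQ k) N1 N2) N3).
rewrite (sclassM (S := grQ_sect G k) N1 N2).
have T1 : cl k ([~ a, b^-1, c] ^ b) = (- cl k [~ a, b, c])%R.
  by rewrite -e1; apply: cl_jacobi_term.
have T2 : cl k ([~ b, c^-1, a] ^ c) = (- cl k [~ b, c, a])%R.
  by rewrite -e2; apply: cl_jacobi_term.
have T3 : cl k ([~ c, a^-1, b] ^ a) = (- cl k [~ c, a, b])%R.
  by rewrite -e3; apply: cl_jacobi_term.
rewrite T1 T2 T3 sclass1 -!opprD => /eqP; rewrite oppr_eq0 => /eqP.
exact.
Qed.

Definition grQ : gradedLie :=
  GradedLie grQ_brDl grQ_brDr grQ_brxx grQ_brC grQ_jacobi.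

Definition grQ_class n (x : G) : grQ n := sclass (grQ_sect G n) x.

End GradedLieOfGroup.

Section FreeAbelian.
Variables (T : choiceType) (V : zmodType).
Implicit Types (h : T -> V) (g : {malg int[T]}).
Local Open Scope ring_scope.

(* The additive extension of h to the free abelian group on T. *)
Definition zlift h g : V := \sum_(k <- msupp g) h k *~ g@_k.

Lemma zliftEw h g (d : {fset T}) : fsubset (msupp g) d ->
  zlift h g = \sum_(k <- d) h k *~ g@_k.
Proof.
move=> le; rewrite /zlift (big_fset_incl _ le) // => k _ /mcoeff_outdom ->.
by rewrite mulr0z.
Qed.

Fact zlift_zmod h : zmod_morphism (zlift h).
Proof.
move=> g1 g2; pose d := (msupp g1 `|` msupp g2)%fset.
rewrite (zliftEw h (msuppB_le g1 g2)) (@zliftEw h g1 d) ?fsubsetUl //.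
rewrite (@zliftEw h g2 d) ?fsubsetUr // -sumrB; apply: eq_bigr => k _.
by rewrite mcoeffB mulrzBr.
Qed.

HB.instance Definition _ h :=
  GRing.isZmodMorphism.Build {malg int[T]} V (zlift h) (zlift_zmod h).

Lemma zliftU h k z : zlift h << z *g k >> = h k *~ z.
Proof.
by rewrite (zliftEw h msuppU_le) big_seq_fset1 mcoeffUU.
Qed.

Lemma malgUz (k : T) (z : int) : << z *g k >> = << k >> *~ z :> {malg int[T]}.
Proof. by rewrite -[z in LHS]intz -raddfMz. Qed.

Lemma malg_additive_ext (f1 f2 : {additive {malg int[T]} -> V}) :
  (forall k, f1 << k >> = f2 << k >>) -> f1 =1 f2.
Proof.
move=> E g; rewrite [g]monalgE !raddf_sum; apply: eq_bigr => k _.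
by rewrite malgUz !raddfMz E.
Qed.

End FreeAbelian.

Section GroupRing.
Variable A : groupType.

(* The integral group ring of A. *)
Definition zgring : Type := {malg int[A]}.
HB.instance Definition _ := GRing.Zmodule.on zgring.

Definition zgU (a : A) : zgring := << a >>%R.

Local Open Scope ring_scope.

Definition zg_one : zgring := zgU 1%g.
Definition zg_mul (g h : zgring) : zgring :=
  zlift (fun a => zlift (fun b => zgU (a * b)%g) h) g.

Fact zg_mulBl : left_distributive zg_mul +%R.
Proof. by move=> x y z; rewrite /zg_mul raddfD. Qed.

Fact zg_mulDr : right_distributive zg_mul +%R.
Proof.
move=> x y z; rewrite /zg_mul -big_split; apply: eq_bigr => a _ /=.
by rewrite raddfD mulrzDl.
Qed.

Fact zg_mulBr x : zmod_morphism (zg_mul x).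
Proof.
move=> y z; apply/eqP; rewrite eq_sym subr_eq -zg_mulDr; apply/eqP.
by rewrite subrK.
Qed.
HB.instance Definition _ x :=
  GRing.isZmodMorphism.Build zgring zgring (zg_mul x) (zg_mulBr x).

Lemma zg_mulU a b : zg_mul (zgU a) (zgU b) = zgU (a * b)%g.
Proof. by rewrite /zg_mul !zliftU. Qed.

Lemma zg_ext (V : zmodType) (f1 f2 : zgring -> V) :
  zmod_morphism f1 -> zmod_morphism f2 ->
  (forall a, f1 (zgU a) = f2 (zgU a)) -> f1 =1 f2.
Proof.
move=> m1 m2 E.
pose F1 : {additive {malg int[A]} -> V} :=
  HB.pack f1 (GRing.isZmodMorphism.Build _ _ f1 m1).
pose F2 : {additive {malg int[A]} -> V} :=
  HB.pack f2 (GRing.isZmodMorphism.Build _ _ f2 m2).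
exact: (malg_additive_ext (f1 := F1) (f2 := F2)).
Qed.

Fact zg_mulA : associative zg_mul.
Proof.
have Bl z : zmod_morphism (zg_mul^~ z) by move=> x y; rewrite /zg_mul raddfB.
move=> x y z; move: x; apply: zg_ext => [x x'|x x'|a].
- exact: Bl.
- by rewrite Bl; exact: Bl.
move: y; apply: zg_ext => [y y'|y y'|b].
- by rewrite Bl; exact: zg_mulBr.
- by rewrite zg_mulBr; exact: Bl.
move: z; apply: zg_ext => [z z'|z z'|c].
- by rewrite zg_mulBr; exact: zg_mulBr.
- exact: zg_mulBr.
by rewrite !zg_mulU mulgA.
Qed.

Fact zg_mul1r : left_id zg_one zg_mul.
Proof.
apply: zg_ext => [x y|//|a]; first by rewrite raddfB.
by rewrite zg_mulU mul1g.
Qed.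

Fact zg_mulr1 : right_id zg_one zg_mul.
Proof.
apply: zg_ext => [x y|//|a]; first by rewrite /zg_mul raddfB.
by rewrite zg_mulU mulg1.
Qed.

Fact zg_one_neq0 : zg_one != 0.
Proof. by rewrite /zg_one /zgU monalgU_eq0. Qed.

HB.instance Definition _ := GRing.Zmodule_isNzRing.Build zgring
  zg_mulA zg_mul1r zg_mulr1 zg_mulBl zg_mulDr zg_one_neq0.

End GroupRing.

Section GroupRingMap.
Variables (A B : groupType) (f : groupHom A B).
Local Open Scope ring_scope.

Definition zgmap (g : zgring A) : zgring B := zlift (fun a => zgU (f a)) g.

Lemma zgmapU a : zgmap (zgU a) = zgU (f a).
Proof. by rewrite /zgmap zliftU. Qed.

Fact zgmap_zmod : zmod_morphism zgmap.
Proof. by move=> x y; rewrite /zgmap raddfB. Qed.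
HB.instance Definition _ :=
  GRing.isZmodMorphism.Build (zgring A) (zgring B) zgmap zgmap_zmod.

Fact zgmap_monoid : monoid_morphism zgmap.
Proof.
split=> [|x y]; first by rewrite zgmapU gmulf1.
move: x; apply: zg_ext => [x x'|x x'|a].
- by rewrite mulrBl raddfB.
- by rewrite raddfB mulrBl.
move: y; apply: zg_ext => [y y'|y y'|b].
- by rewrite mulrBr raddfB.
- by rewrite raddfB mulrBr.
by rewrite [_ * _]zg_mulU !zgmapU gmulfM [RHS]zg_mulU.
Qed.
HB.instance Definition _ :=
  GRing.isMonoidMorphism.Build (zgring A) (zgring B) zgmap zgmap_monoid.

End GroupRingMap.

Section RestrictionOfScalars.
Variables (R S : nzRingType) (f : {rmorphism R -> S}) (V : lmodType S).
Local Open Scope ring_scope.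

(* V with scalars restricted along f. *)
Definition restrict of {rmorphism R -> S} : Type := V.
Local Notation W := (restrict f).
HB.instance Definition _ := GRing.Zmodule.on W.

Definition restrict_scale (r : R) (v : W) : W := f r *: (v : V).

Fact restrict_scaleA a b v :
  restrict_scale a (restrict_scale b v) = restrict_scale (a * b) v.
Proof. by rewrite /restrict_scale scalerA rmorphM. Qed.

Fact restrict_scale1 : left_id 1 restrict_scale.
Proof. by move=> v; rewrite /restrict_scale rmorph1 scale1r. Qed.

Fact restrict_scaleDr : right_distributive restrict_scale +%R.
Proof. by move=> a u v; rewrite /restrict_scale scalerDr. Qed.

Fact restrict_scaleDl v : {morph restrict_scale^~ v : a b / a + b}.
Proof. by move=> a b; rewrite /restrict_scale rmorphD scalerDl. Qed.

HB.instance Definition _ := GRing.Zmodule_isLmodule.Build R W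
  restrict_scaleA restrict_scale1 restrict_scaleDr restrict_scaleDl.

End RestrictionOfScalars.

Section AlexanderInvariant.
Variable G : groupType.

(* B_Q(G) = G'_Q / G''_Q. *)
Definition BQ : Type := sect (BQ_sect G).
HB.instance Definition _ := GRing.Zmodule.on BQ.

Definition BQ_class (x : G) : BQ := sclass (BQ_sect G) x.

Local Notation D1 := (derivedQ1 G).
Local Notation D2 := (derivedQ2 G).
Let s1 := derivedQ1_subgroup G.
Let s2 := derivedQ2_subgroup G.
Let c1 := @derivedQ1_conj G.
Let c2 := @derivedQ2_conj G.

(* The action of the class of g sends the class of x to that of g x g^-1. *)
Definition BQ_conj (a : abf G) (b : BQ) : BQ :=
  BQ_class (srepr b ^ (repr a)^-1).

Lemma BQ_conjE g x : D1 x ->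
  BQ_conj (qclass _ g) (BQ_class x) = BQ_class (x ^ g^-1).
Proof.
move=> Dx; set h := repr (qclass (derivedQ1_normal G) g).
have Dh : D1 (h / g) := repr_qclass (derivedQ1_normal G) g.
have Dx' : D1 (srepr (BQ_class x)) := srepr_numer (S := BQ_sect G) _.
have E : D2 (srepr (BQ_class x) / x) := srepr_class (S := BQ_sect G) Dx.
apply: (@etrans _ _ (BQ_class (x ^ h^-1))).
  by apply/(sclass_eqP (S := BQ_sect G)); [exact: c1|exact: c1|rewrite -conjVg -conjMg; exact: c2].
apply/(sclass_eqP (S := BQ_sect G)); [exact: c1|exact: c1|].
have {1}-> : h^-1 = g^-1 * (h / g)^-1 by rewrite invgF mulgA mulVg mul1g.
rewrite conjgM; set y := x ^ g^-1; have Dy : D1 y by exact: c1.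
have -> : y ^ (h / g)^-1 / y = [~ (h / g)^-1, y^-1] by rewrite commgEr invgK.
by apply: derivedQ2_comm; exact: sgV.
Qed.

Lemma BQP (b : BQ) : exists2 x, D1 x & b = BQ_class x.
Proof. by exists (srepr b); [exact: (srepr_numer (S := BQ_sect G))|rewrite [RHS](sreprK (S := BQ_sect G))]. Qed.

Lemma BQ_classM x y : D1 x -> D1 y ->
  BQ_class (x * y) = (BQ_class x + BQ_class y)%R.
Proof. exact: (sclassM (S := BQ_sect G)). Qed.

Lemma BQ_conjD a : {morph BQ_conj a : b b' / (b + b')%R}.
Proof.
move=> b b'; have [x Dx ->] := BQP b; have [y Dy ->] := BQP b'.
rewrite -[a]qclassK -BQ_classM // !BQ_conjE //; last exact: sgM.
by rewrite conjMg BQ_classM //; exact: c1.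
Qed.

Lemma BQ_conjM a a' b : BQ_conj (a * a') b = BQ_conj a (BQ_conj a' b).
Proof.
have [x Dx ->] := BQP b; rewrite -[a]qclassK -[a']qclassK -gmulfM.
by rewrite !BQ_conjE //; [rewrite invgM conjgM|exact: c1].
Qed.

Lemma BQ_conj1 b : BQ_conj 1 b = b.
Proof.
have [x Dx ->] := BQP b.
have -> : 1 = qclass (derivedQ1_normal G) 1 :> abf G by [].
by rewrite BQ_conjE // invg1 conjg1.
Qed.

Local Open Scope ring_scope.

Definition BQ_scale (z : zgring (abf G)) (b : BQ) : BQ :=
  zlift (fun a => BQ_conj a b) z.

Lemma BQ_scaleU a b : BQ_scale (zgU a) b = BQ_conj a b.
Proof. by rewrite /BQ_scale zliftU. Qed.

Fact BQ_scaleDl b : {morph BQ_scale^~ b : x y / x + y}.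
Proof. by move=> x y; rewrite /BQ_scale raddfD. Qed.

Fact BQ_scaleBl b : zmod_morphism (BQ_scale^~ b).
Proof. by move=> x y; rewrite /BQ_scale raddfB. Qed.

Fact BQ_scaleDr : right_distributive BQ_scale +%R.
Proof.
move=> x b b'; rewrite /BQ_scale /zlift -big_split; apply: eq_bigr => a _ /=.
by rewrite -mulrzDl -BQ_conjD.
Qed.

Fact BQ_scaleBr x : zmod_morphism (BQ_scale x).
Proof.
move=> y z; apply/eqP; rewrite eq_sym subr_eq -BQ_scaleDr; apply/eqP.
by rewrite subrK.
Qed.

Fact BQ_scale1 : left_id 1 BQ_scale.
Proof. by move=> b; rewrite BQ_scaleU BQ_conj1. Qed.

Fact BQ_scaleA x y b : BQ_scale x (BQ_scale y b) = BQ_scale (x * y) b.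
Proof.
move: x; apply: zg_ext => [x x'|x x'|a]; rewrite ?mulrBl ?BQ_scaleBl //.
move: y; apply: zg_ext => [y y'|y y'|c].
- by rewrite BQ_scaleBl BQ_scaleBr.
- by rewrite mulrBr BQ_scaleBl.
by rewrite [_ * _]zg_mulU !BQ_scaleU BQ_conjM.
Qed.

HB.instance Definition _ := GRing.Zmodule_isLmodule.Build (zgring (abf G)) BQ
  BQ_scaleA BQ_scale1 BQ_scaleDr BQ_scaleDl.

End AlexanderInvariant.

Section QuotientSpace.
Variables (R : nzRingType) (V : lmodType R) (X : set V).
Local Open Scope ring_scope.

Definition lspan : set V := smallest [set W : set V | submod_closed [in W]] X.

Definition lspan_pred : {pred V} := [in lspan].

Fact lspan_submod : submod_closed lspan_pred.
Proof.
split; first by apply/mem_set => W [[/set_mem]].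
move=> a u v /set_mem Xu /set_mem Xv; apply/mem_set => W WP.
case: (WP) => -[_ WL] _; apply/set_mem/WL; apply/mem_set; first exact: Xu.
exact: Xv.
Qed.

HB.instance Definition _ :=
  GRing.isZmodClosed.Build V lspan_pred (GRing.submod_closedB lspan_submod).

Definition quotv : Type := Quotient.quot lspan_pred.
HB.instance Definition _ := EqQuotient.on quotv.
HB.instance Definition _ := GRing.Zmodule.on quotv.

Definition quotv_pi (v : V) : quotv := \pi_(Quotient.quot lspan_pred) v.

Lemma quotv_piP u v : quotv_pi u = quotv_pi v <-> lspan (u - v).
Proof.
split=> [/eqP|h]; first by rewrite -Quotient.idealrBE => /set_mem.
by apply/eqP; rewrite -Quotient.idealrBE; apply/mem_set.
Qed.

Lemma quotv_reprK (u : quotv) : quotv_pi (repr u) = u.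
Proof. exact: reprK. Qed.

Lemma quotv_piD : {morph quotv_pi : x y / x + y}.
Proof. by move=> x y; rewrite /quotv_pi raddfD. Qed.

Definition quotv_scale (a : R) (u : quotv) : quotv := quotv_pi (a *: repr u).

Lemma quotv_scaleE a v : quotv_scale a (quotv_pi v) = quotv_pi (a *: v).
Proof.
apply/quotv_piP; rewrite -scalerBr; have /quotv_piP := quotv_reprK (quotv_pi v).
move=> /mem_set h; apply/set_mem.
have [L0 LL] := lspan_submod.
by rewrite -[_ *: _]addr0; apply: LL.
Qed.

Fact quotv_scaleA a b u : quotv_scale a (quotv_scale b u) = quotv_scale (a * b) u.
Proof. by rewrite -[u]quotv_reprK !quotv_scaleE scalerA. Qed.

Fact quotv_scale1 : left_id 1 quotv_scale.
Proof. by move=> u; rewrite -[u]quotv_reprK quotv_scaleE scale1r. Qed.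

Fact quotv_scaleDr : right_distributive quotv_scale +%R.
Proof.
move=> a u v; rewrite -[u]quotv_reprK -[v]quotv_reprK.
by rewrite -quotv_piD !quotv_scaleE scalerDr quotv_piD.
Qed.

Fact quotv_scaleDl u : {morph quotv_scale^~ u : a b / a + b}.
Proof.
by move=> a b; rewrite -[u]quotv_reprK !quotv_scaleE scalerDl quotv_piD.
Qed.

HB.instance Definition _ := GRing.Zmodule_isLmodule.Build R quotv
  quotv_scaleA quotv_scale1 quotv_scaleDr quotv_scaleDl.

End QuotientSpace.

Section RationalSpaces.
Local Open Scope ring_scope.

Lemma lspan_min (R : nzRingType) (V : lmodType R) (X W : set V) :
  submod_closed [in W] -> X `<=` W -> lspan X `<=` W.
Proof. by move=> sW XW v; apply. Qed.

Lemma lspan_sub (R : nzRingType) (V : lmodType R) (X : set V) : X `<=` lspan X.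
Proof. by move=> v Xv W [_]; apply. Qed.

(* H_1(G; Q) computed from the bar resolution: the first differential with
   trivial coefficients is zero and the second sends [x|y] to [y] - [xy] + [x]. *)
Definition H1Q_boundary (G : groupType) : set {malg rat[G]} :=
  [set << y >> - << (x * y)%g >> + << x >> | x in [set: G] & y in [set: G]].
Definition H1Q (G : groupType) : lmodType rat := quotv (@H1Q_boundary G).

(* The extension of scalars of A from the integers to rat: the rational vector
   space generated by A with the addition of A for relations. *)
Definition tensorQ_rel (A : zmodType) : set {malg rat[A]} :=
  [set << x + y >> - << x >> - << y >> | x in [set: A] & y in [set: A]].
Definition tensorQ (A : zmodType) : lmodType rat := quotv (@tensorQ_rel A).

Definition tensorQ_in (A : zmodType) (a : A) : tensorQ A := quotv_pi (@tensorQ_rel A) << a >>.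

Lemma tensorQ_inD (A : zmodType) : {morph @tensorQ_in A : x y / x + y}.
Proof.
move=> x y; rewrite -quotv_piD; apply/quotv_piP; apply: lspan_sub.
by exists x => //; exists y => //; rewrite opprD addrA.
Qed.

Lemma tensorQ_universal (A : zmodType) (V : lmodType rat) (h : {additive A -> V}) :
  exists! f : tensorQ A -> V, linear f /\ forall a, f (tensorQ_in a) = h a.
Proof.
pose F (g : {malg rat[A]}) : V := \sum_(k <- msupp g) g@_k *: h k.
have FE g (d : {fset A}) : fsubset (msupp g) d -> F g = \sum_(k <- d) g@_k *: h k.
  move=> le; rewrite /F (big_fset_incl _ le) // => k _ /mcoeff_outdom ->.
  by rewrite scale0r.
have FL : linear F.
  move=> a u v; pose d := (msupp (a *: u) `|` msupp u `|` msupp v)%fset.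
  have su : fsubset (msupp u) d by rewrite /d -fsetUA fsetUCA fsubsetUl.
  have sv : fsubset (msupp v) d by rewrite fsubsetUr.
  have sw : fsubset (msupp (a *: u + v)) d.
    apply: fsubset_trans (msuppD_le _ _) _.
    by rewrite fsubUset sv andbT /d -fsetUA fsubsetUl.
  rewrite (FE _ d sw) (FE _ d su) (FE _ d sv) scaler_sumr -big_split.
  by apply: eq_bigr => k _; rewrite /= mcoeffD mcoeffZ scalerDl scalerA.
have FU k : F << k >> = h k by rewrite (FE _ _ msuppU_le) big_seq_fset1 mcoeffUU scale1r.
have FB u v : F (u - v) = F u - F v.
  by have := FL (-1) v u; rewrite !scaleN1r ![- _ + _]addrC.
have F0 u v : quotv_pi (@tensorQ_rel A) u = quotv_pi (@tensorQ_rel A) v -> F u = F v.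
  move/quotv_piP => L; apply/eqP; rewrite -subr_eq0 -FB; apply/eqP.
  move: (u - v) L; apply: (@lspan_min _ _ _ [set w | F w = 0]).
    split; first by apply/mem_set; rewrite /mkset -[0](subrr 0) FB subrr.
    move=> a x y /set_mem /= Fx /set_mem /= Fy.
    by apply/mem_set; rewrite /mkset FL Fx Fy scaler0 addr0.
  move=> _ [x _ [y _ <-]]; rewrite /mkset !FB !FU raddfD.
  by rewrite -addrA -opprD subrr.
exists (fun t => F (repr t)); split.
  split=> [a u v|a]; last by rewrite -FU; apply: F0; rewrite quotv_reprK.
  rewrite -FL; apply: F0; rewrite quotv_reprK quotv_piD.
  by rewrite -[quotv_pi _ (_ *: _)]quotv_scaleE !quotv_reprK.
move=> f [fL fh]; apply/funext => t; rewrite -[t in RHS]quotv_reprK.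
have f0 : f 0 = 0.
  by have := fL (-1) 0 0; rewrite scaleN1r oppr0 addr0 scaleN1r addNr.
rewrite [in RHS](monalgE (repr t)) /F.
elim: (enum_fset _) => [|k s IH]; first by rewrite !big_nil -[LHS]f0 /quotv_pi raddf0.
rewrite !big_cons quotv_piD.
have -> : << (repr t)@_k *g k >> = (repr t)@_k *: << k >> :> {malg rat[A]}.
  by apply/malgP=> j; rewrite mcoeffZ !mcoeffU mulrnAr mulr1.
by rewrite -[quotv_pi _ (_ *: _)]quotv_scaleE fL -IH -fh.
Qed.

Definition has_dimQ (V : lmodType rat) (d : nat) : Prop :=
  exists f : {linear V -> 'rV[rat]_d}, bijective f.

Definition fin_dimQ (V : lmodType rat) : Prop := exists d, has_dimQ V d.

(* Equal to 0 on infinite-dimensional spaces. *)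
Definition dimQ (V : lmodType rat) : nat := xget 0%N [set d | has_dimQ V d].

Definition gr_tensorQ (n : nat) (G : groupType) : lmodType rat :=
  tensorQ (sect (gr_sect G n)).

Definition phi (n : nat) (G : groupType) : nat := dimQ (gr_tensorQ n G).
Definition theta (n : nat) (G : groupType) : nat := phi n (metab G).

End RationalSpaces.

Definition fin_generated (G : groupType) : Prop :=
  exists s : seq G, generated [set` s] = [set: G].

Definition torsion_free (G : groupType) : Prop :=
  forall (x : G) n, (0 < n)%N -> x ^+ n = 1 -> x = 1.

Section Exactness.
Variables (K G Q : groupType) (i : groupHom K G) (p : groupHom G Q).

Definition short_exact : Prop :=
  [/\ injective i, range i = [set g | p g = 1] & range p = [set: Q]].

End Exactness.

Definition abf_exact (K G Q : groupType) (i : groupHom K G) (p : groupHom G Q) :=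
  short_exact i p /\ short_exact (abf_map i) (abf_map p).

(* F is the map induced by f in the degrees >= d. *)
Definition grQ_induced d (G H : groupType) (f : groupHom G H)
    (F : forall n, grQ G n -> grQ H n) : Prop :=
  forall n x, (d <= n)%N -> gammaQ G n x -> F n (grQ_class n x) = grQ_class n (f x).

(* Main.v *)
Require Import Defs.
From HB Require Import structures.
From mathcomp Require Import all_boot all_order all_algebra.
From mathcomp Require Import mathcomp_extra boolp classical_sets.
From mathcomp Require Import finmap monalg.

(** Regard K as a subgroup of G. Since Q is abelian and torsion-free, the roots of
    G' lie in K, and the injectivity of K_abf -> G_abf makes them roots of K'. So
    K and G have the same derivedQ1, hence the same derivedQ2 and the same
    invariant B_Q ([derivedQ1_image], [derivedQ2_image], [BQ_iso]).

    As [G, K] lies in derivedQ1 K, the group G acts trivially on K_abf, hence on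
    the torsion-free quotients gammaQ n K / gammaQ n.+1 K, which are generated up
    to roots by iterated commutators ([gammaQ_conj_image]). This means that
    [G, gammaQ n K] lies in gammaQ n.+1 K, and by induction gammaQ n K = gammaQ n G
    for all n >= 2 ([gammaQ_image], [gammaQ_preimage], [grQ_iso]). The argument is
    given for a homomorphism f : K -> G mapping gammaQ 2 K onto gammaQ 2 G whose
    kernel lies in every gammaQ n K, so as to apply also to K/K'' -> G/G'', which
    may fail to be injective. The kernel of the latter comes from derivedQ2 K; and
    in a torsion-free nilpotent quotient of the metabelian group K/K'', two roots
    of elements of the derived subgroup have commuting powers and therefore commute
    ([derivedQ2_gammaQ]).

    For the ranks, gammaQ n is the set of roots of gamma n ([gammaQE]: the torsion
    elements of a nilpotent group form a subgroup). Hence gr_n K -> gr_n G has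
    torsion kernel and cokernel for n >= 2 and torsion kernel for n = 1, and it
    becomes bijective, resp. injective, over the rationals. Finally gr_1 is
    finite-dimensional over the rationals when G_abf is finitely generated or b_1(G)
    is finite, and then so are all gr_n, being spanned by brackets
    ([gr_fin_span_step]). *)

Set Implicit Arguments.
Unset Strict Implicit.
Unset Printing Implicit Defensive.

Import GRing.Theory Num.Theory.

Local Open Scope classical_set_scope.
Local Open Scope group_scope.

(** * Subgroups, roots and abelian sections *)

Lemma inj_surj_bij (T U : Type) (f : T -> U) :
  injective f -> (forall y, exists x, f x = y) -> bijective f.
Proof.
move=> injf surjf; pose g y := projT1 (cid (surjf y)).
have gK : cancel g f by move=> y; exact: (projT2 (cid (surjf y))).
by exists g => // x; apply: injf; rewrite gK.
Qed.

Section Subgroups.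
Variable G : groupType.
Implicit Types (A B E F : set G) (x y g : G).

Lemma conj_commg x g : x ^ g = x * [~ x, g].
Proof. by rewrite commgEl mulVKg. Qed.

Lemma image_subgroup (H : groupType) (f : groupHom G H) A :
  is_subgroup A -> is_subgroup (f @` A).
Proof.
move=> sA; split; first by exists 1; [case: sA|exact: gmulf1].
move=> _ _ [x Ax <-] [y Ay <-]; exists (x / y); last exact: gmulfF.
exact: sA.2.
Qed.

Lemma setI_isol_subgroup A B : is_subgroup A -> is_subgroup B -> B `<=` A ->
  (forall x y, A x -> A y -> B [~ x, y]) -> is_subgroup (A `&` isol B).
Proof.
move=> sA sB BA cAB; pose S := AbSect sA sB BA cAB.
have tors x m : A x -> B (x ^+ m) <-> (sclass S x *+ m = 0)%R.
  move=> Ax; rewrite -sclassX //; symmetry; apply: (sclass0P (S := S)).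
  exact: (sgX _ sA Ax).
split; first by split; [exact: sA.1|apply: sub_isol; exact: sB.1].
move=> x y [Ax [m m0 Bx]] [Ay [n n0 By]]; have Axy : A (x / y) by exact: sA.2.
split=> //; exists (m * n)%N; first by rewrite muln_gt0 m0.
apply/tors => //; move/tors: Bx => /(_ Ax) sx; move/tors: By => /(_ Ay) sy.
rewrite (sclassM (S := S)) ?(sclassV (S := S)) //; last exact: sgV.
by rewrite mulrnDl mulrnA sx mul0rn add0r mulNrn mulnC mulrnA sy mul0rn oppr0.
Qed.

(** When [x, y] is central modulo F, the bracket with y is a homomorphism on the
    powers of x modulo F. *)
Lemma commXg_mod F x y m : is_subgroup F -> is_conj_stable F ->
    (forall g, F [~ [~ x, y], g]) -> F ([~ x ^+ m, y] / [~ x, y] ^+ m).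
Proof.
move=> sF cF cen; elim: m => [|m IH].
  by rewrite !expg0 comm1g divgg; case: sF.
rewrite !expgS commMg conj_commg invgM; set c := [~ x, y] in cen IH *.
set u := [~ x ^+ m, y] in IH *; have := sgM sF (cen (x ^+ m)) IH.
by move=> /(cF _ c^-1); rewrite conjgE invgK !mulgA.
Qed.

(** As [x, g] lies in E', it is central modulo F, so [x, g]^m = [x^m, g] = 1
    modulo F. Since E'/F is abelian, its torsion is a subgroup, and it contains
    the generators of E'. *)
Lemma torsion_commS A E E' F : is_subgroup E' ->
    is_subgroup F -> is_conj_stable F -> F `<=` E' -> A `<=` F ->
    (forall g y, E' y -> F [~ g, y]) -> (forall g x, E x -> E' [~ g, x]) ->
    (forall x, E x -> exists2 m, (0 < m)%N & forall g, F [~ x ^+ m, g]) ->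
  E' `<=` generated (A `|` [set z | exists g, exists2 x, E x & z = [~ g, x]]) ->
  E' `<=` isol F.
Proof.
move=> sE' sF cF FE' AF GE' GE tE sub y E'y.
suff: (E' `&` isol F) y by case.
move/sub: E'y => {sub}; move: y; apply: (@generated_min _ _ (E' `&` isol F)).
  by apply: setI_isol_subgroup => // a b _ E'b; apply: GE'.
move=> z [Az|[g [x Ex ->]]]; first by split; [exact/FE'/AF|exact/sub_isol/AF].
rewrite -invgR; apply: sgV.
  by apply: setI_isol_subgroup => // a b _ E'b; apply: GE'.
have E'xg : E' [~ x, g] by rewrite -invgR; apply: sgV => //; apply: GE.
split=> //; have [m m0 Fm] := tE x Ex; exists m => //.
have := @commXg_mod F x g m sF cF.
have cen h : F [~ [~ x, g], h] by rewrite -invgR; apply: sgV => //; apply: GE'.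
move=> /(_ cen)/(sgV sF); rewrite invgF => /(sgM sF)/(_ (Fm g)).
by rewrite mulgVK.
Qed.

End Subgroups.

Section SectionMap.
Variables (G H : groupType) (S : absect G) (T : absect H) (f : groupHom G H).
Hypotheses (fN : forall x, numer S x -> numer T (f x))
           (fD : forall x, denom S x -> denom T (f x)).

Definition sect_map (u : sect S) : sect T := sclass T (f (srepr u)).

Lemma sect_mapE x : numer S x -> sect_map (sclass S x) = sclass T (f x).
Proof.
move=> Nx; apply/sclass_eqP; first exact/fN/srepr_numer.
  exact: fN.
by rewrite -gmulfF; apply/fD/srepr_class.
Qed.

Lemma sect_mapD : {morph sect_map : u v / (u + v)%R}.
Proof.
move=> u v; rewrite -[u]sreprK -[v]sreprK.
have [Nu Nv] := (srepr_numer u, srepr_numer v).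
rewrite -sclassM // !sect_mapE ?gmulfM ?sclassM //; try exact: fN.
exact: sgM (numer_subgroup S) Nu Nv.
Qed.

Lemma sect_map_inj :
  (forall x, numer S x -> denom T (f x) -> denom S x) -> injective sect_map.
Proof.
move=> f_inj u v; rewrite -[u]sreprK -[v]sreprK.
have [Nu Nv] := (srepr_numer u, srepr_numer v); rewrite !sect_mapE //.
move/(sclass_eqP (S := T)) => /(_ (fN Nu) (fN Nv)); rewrite -gmulfF => Duv.
by apply/sclass_eqP => //; apply: f_inj => //; apply: (numer_subgroup S).2.
Qed.

Lemma sect_map_surj :
  numer T `<=` f @` numer S -> forall v, exists u, sect_map u = v.
Proof.
move=> f_surj v; have [x Nx E] := f_surj _ (srepr_numer v).
by exists (sclass S x); rewrite sect_mapE // E sreprK.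
Qed.

End SectionMap.

(** * The rational lower central series *)

Section RationalLowerCentralSeries.
Variable G : groupType.
Implicit Types x y g : G.

Let gs := @gamma_subgroup G.
Let gc := @gamma_conj G.
Let qs := @gammaQ_subgroup G.
Let qc := @gammaQ_conj G.

Lemma gamma_commT n x y : gamma G n y -> gamma G n.+1 [~ x, y].
Proof. by case: n => [|n] // Gy; apply: mem_commS. Qed.

Lemma gamma_anti m n : (m <= n)%N -> gamma G n `<=` gamma G m.
Proof.
elim: n => [|n IH]; first by rewrite leqn0 => /eqP ->.
rewrite leq_eqVlt => /orP[/eqP -> //|/IH s];
  exact: (subset_trans (@gamma_sub G n)).
Qed.

Lemma gammaQ_anti m n : (m <= n)%N -> gammaQ G n `<=` gammaQ G m.
Proof.
elim: n => [|n IH]; first by rewrite leqn0 => /eqP ->.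
rewrite leq_eqVlt => /orP[/eqP -> //|/IH s];
  exact: (subset_trans (@gammaQ_sub G n)).
Qed.

Lemma gamma_gammaQ n : gamma G n `<=` gammaQ G n.
Proof.
elim: n => [|[|n] IH] //; rewrite gammaSS gammaQSS => x Gx.
apply: sub_isol; move: x Gx; apply: generated_min; first exact: commS_subgroup.
by move=> _ [x [y [_ Gy ->]]]; apply: mem_commS => //; apply: IH.
Qed.

(** The descending central series of gammaQ n in G, computed in the nilpotent
    group G / gamma n.+1: each term is enlarged by gamma n.+1, which replaces the
    passage to the quotient. *)
Fixpoint gchain n j : set G :=
  if j is j'.+1 then
    generated (gamma G n.+1 `|`
      [set z | exists g, exists2 x, gchain n j' x & z = [~ g, x]])
  else gammaQ G n.

Lemma gchain_props n j : (0 < n)%N ->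
  [/\ is_subgroup (gchain n j), is_conj_stable (gchain n j),
      gamma G n.+1 `<=` gchain n j & gchain n j.+1 `<=` gchain n j].
Proof.
move=> n0; have gen A : is_conj_stable A -> is_conj_stable
    (generated (gamma G n.+1 `|`
      [set z | exists g, exists2 x, A x & z = [~ g, x]])).
  move=> cA; apply: generated_conj => z h [Gz|[g [x Ax ->]]].
    by left; exact: gc.
  right; exists (g ^ h), (x ^ h); [exact: cA|exact: conjRg].
elim: j => [|j [s c g m]].
  have sub : gamma G n.+1 `<=` gammaQ G n.
    by move=> x /gamma_sub/gamma_gammaQ.
  split; [exact: qs|exact: qc|exact: sub|].
  apply: (generated_min (qs n)) => z [/sub //|[h [x Gx ->]]].
  by apply: gammaQ_sub; apply: gammaQ_commT.
have c' : is_conj_stable (gchain n j.+1) by apply: gen.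
split=> //; first exact: generated_subgroup.
  by move=> x Gx; apply: sub_generated; left.
apply: generated_min; first exact: generated_subgroup.
move=> z [Gz|[h [x Gx ->]]]; apply: sub_generated; first by left.
by right; exists h, x => //; apply: m.
Qed.

Lemma gchain_comm n j g x : gchain n j x -> gchain n j.+1 [~ g, x].
Proof. by move=> Gx; apply: sub_generated; right; exists g, x. Qed.

Lemma gchain_gamma n j : (j <= n)%N -> gchain n j `<=` gamma G j.+1.
Proof.
elim: j => [|j IH] jn //; apply: (generated_min (gs _)) => z [|[g [x Cx ->]]].
  exact: gamma_anti.
by apply: gamma_commT; apply: IH => //; exact: ltnW.
Qed.

(** In the nilpotent group G / gamma n.+1 the torsion elements form a subgroup:
    gammaQ n is torsion modulo gamma n, which is central, so each term of gchain n
    from the first on is torsion modulo the next one, and the n-th term is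
    trivial. *)
Lemma gammaQE n : gammaQ G n = isol (gamma G n).
Proof.
apply/seteqP; split; last first.
  by move=> x /(isolS (@gamma_gammaQ n)) /gammaQ_isol.
elim: n => [|[|n] IH]; [exact: sub_isol|exact: sub_isol|].
have P j := @gchain_props n.+1 j isT.
have step j : gchain n.+1 j.+1 `<=` isol (gchain n.+1 j.+2).
  elim: j => [|j IHj].
    have [s1 c1 _ m1] := P 1%N; have [s2 c2 g2 _] := P 2%N.
    apply: (@torsion_commS _ (gamma G n.+2) (gchain n.+1 0%N)) => //.
    - by move=> g y; apply: gchain_comm.
    - by move=> g y; apply: gchain_comm.
    move=> x /IH [m m0 Gx]; exists m => // g; apply: g2.
    by rewrite -invgR; apply: (sgV (gs _)); apply: gamma_commT.
  have [s1 c1 _ m1] := P j.+2; have [s2 c2 g2 _] := P j.+3.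
  apply: (@torsion_commS _ (gamma G n.+2) (gchain n.+1 j.+1)) => //.
  - by move=> g y; apply: gchain_comm.
  - by move=> g y; apply: gchain_comm.
  move=> x /IHj [m m0 Cx]; exists m => // g.
  by rewrite -invgR; apply: (sgV s2); apply: gchain_comm.
have down j : gchain n.+1 1%N `<=` isol (gchain n.+1 j.+1).
  elim: j => [|j IHj]; first exact: sub_isol.
  by apply: subset_trans IHj _ => x /(isolS (@step j))/isol_idem.
have sub : gammaQ G n.+2 `<=` isol (gchain n.+1 1%N).
  apply: isolS; apply: generated_min; first by have [] := P 1%N.
  by move=> _ [g [x [_ Gx ->]]]; apply: gchain_comm.
move=> x /sub/(isolS (@down n))/isol_idem.
by apply: isolS; apply: gchain_gamma.
Qed.

(** An element of the nilpotent torsion-free group G / gammaQ n that commutes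
    with a power of x commutes with x: once [x, y] lies in gammaQ j it is central
    modulo gammaQ j.+1, so that [x^m, y] = [x, y]^m there. *)
Lemma gammaQ_comm_root n x y m : (0 < m)%N ->
  gammaQ G n [~ x ^+ m, y] -> gammaQ G n [~ x, y].
Proof.
move=> m0 Gm; suff H j : (j <= n)%N -> gammaQ G j [~ x, y] by exact: H.
elim: j => [//|j IH jn]; have Gj := IH (ltnW jn).
apply: gammaQ_isol; exists m => //.
have cen g : gammaQ G j.+1 [~ [~ x, y], g].
  by rewrite -invgR; apply: (sgV (qs _)); apply: gammaQ_commT.
have := @commXg_mod _ _ x y m (qs j.+1) (@qc j.+1) cen.
move=> /(sgV (qs j.+1)); rewrite invgF => /(sgM (qs j.+1)).
by move=> /(_ _ (gammaQ_anti jn Gm)); rewrite mulgVK.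
Qed.

(** In a metabelian group the commutators of roots of elements of the derived
    subgroup die in every torsion-free nilpotent quotient. *)
Lemma derivedQ2_gammaQ n :
  derived2 G `<=` [set 1] -> derivedQ2 G `<=` gammaQ G n.
Proof.
move=> D2 x /isolS; move/(_ (gammaQ G n)) => sub; apply/gammaQ_isol/sub.
apply: (generated_min (qs n)) => _ [a [b [[k k0 Da] [m m0 Db] ->]]].
apply: (gammaQ_comm_root k0); rewrite -invgR; apply: (sgV (qs n)).
apply: (gammaQ_comm_root m0); rewrite -invgR.
have /D2 -> : derived2 G [~ a ^+ k, b ^+ m] by apply: mem_commS.
by rewrite invg1; exact: (qs n).1.
Qed.

End RationalLowerCentralSeries.

(** * Homomorphisms that preserve the rational lower central series *)

Section LowerCentralFunctoriality.
Variables (G H : groupType) (f : groupHom G H).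

Lemma gamma_hom n x : gamma G n x -> gamma H n (f x).
Proof. by elim: n x => [|[|n] IH] // x; apply: commS_hom. Qed.

Lemma gammaQ_hom n x : gammaQ G n x -> gammaQ H n (f x).
Proof. by elim: n x => [|[|n] IH] // x; apply: isol_hom; apply: commS_hom. Qed.

End LowerCentralFunctoriality.

Section LowerCentralComparison.
Variables (K G : groupType) (f : groupHom K G).
Hypothesis f_gammaQ2 : gammaQ G 2 `<=` f @` gammaQ K 2.
Hypothesis f_ker : forall n x, f x = 1 -> gammaQ K n x.

Lemma gammaQ_eq_mod n x y : f x = f y -> gammaQ K n (x^-1 * y).
Proof. by move=> E; apply: f_ker; rewrite gmulfM gmulfV E mulVg. Qed.

Lemma gammaQ_conj_image1 g x : exists2 e, gammaQ K 2 e & f x ^ g = f (x * e).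
Proof.
have [e Ke E] : (f @` gammaQ K 2) [~ f x, g] by apply/f_gammaQ2/gammaQ_commT.
by exists e => //; rewrite gmulfM E -conj_commg.
Qed.

Lemma gammaQ_comm_mod n k c y d : gammaQ K 2 c -> gammaQ K n.+1 y ->
  gammaQ K n.+2 d -> gammaQ K n.+3 ([~ k, y]^-1 * [~ k * c, y * d]).
Proof.
move=> Kc Ky Kd; have sK := @gammaQ_subgroup K.
have Kc1 : gammaQ K 1 c by [].
have Kk1 : gammaQ K 1 k by [].
have Kd1 := gammaQ_sub Kd; have Kyd := sgM (sK _) Ky Kd1.
have Kky : gammaQ K (1 + n.+1) [~ k, y] := gammaQ_comm Kk1 Ky.
have Kkcyd : gammaQ K (1 + n.+1) [~ k * c, y * d].
  exact: gammaQ_comm.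
apply/(sclass0P (S := grQ_sect K (1 + n.+1))).
  exact: sgM (sK _) (sgV (sK _) Kky) Kkcyd.
rewrite sclassM ?sclassV //; last exact: (sgV (sK _) Kky).
rewrite cl_commMl // cl_commMr // (cl0 (x := [~ k, d])); last first.
  exact: (gammaQ_comm Kk1 Kd).
rewrite (cl0 (x := [~ c, y * d])); last exact: (gammaQ_comm Kc Kyd).
by rewrite !addr0 addNr.
Qed.

(** G acts trivially on the abelianization of K up to torsion, hence on each
    torsion-free quotient gammaQ K n.+1 / gammaQ K n.+2, whose elements have
    powers that are products of iterated commutators. *)
Lemma gammaQ_conj_image n g x : gammaQ K n.+1 x ->
  exists2 e, gammaQ K n.+2 e & f x ^ g = f (x * e).
Proof.
elim: n g x => [|n IH] g x Kx; first exact: gammaQ_conj_image1.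
have sK := @gammaQ_subgroup K; have cK := @gammaQ_conj K.
have [m m0 Cx] : isol (commS setT (gammaQ K n.+1)) x by [].
have [d Kd Ed] := IH g x (gammaQ_sub Kx).
exists d => //.
have [e Ke Ee] : exists2 e, gammaQ K n.+3 e & f (x ^+ m) ^ g = f (x ^+ m * e).
  move: {m0 d Kd Ed} (x ^+ m) Cx.
  apply: (@generated_min _ _
    [set w | exists2 e, gammaQ K n.+3 e & f w ^ g = f (w * e)]).
    split; first by exists 1; [exact: (sK n.+3).1|rewrite mulg1 gmulf1 conj1g].
    move=> u v [e Ke Eu] [e' Ke' Ev].
    exists ((e / e') ^ v^-1); first by apply: cK; apply: (sK n.+3).2.
    have -> : f (u / v) ^ g = f (u * e) / f (v * e')
      by rewrite gmulfF conjMg conjVg Eu Ev.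
    rewrite -gmulfF; congr (f _).
    by rewrite conjgE !invgM invgK !mulgA mulgVK.
  move=> _ [k [y [_ Ky ->]]].
  have [c Kc Ec] := gammaQ_conj_image1 g k; have [b Kb Eb] := IH g y Ky.
  exists ([~ k, y]^-1 * [~ k * c, y * b]); first exact: gammaQ_comm_mod.
  by rewrite mulVKg gmulfR conjRg Ec Eb gmulfR.
have Ke1 := gammaQ_sub Ke.
have Kxm := sgX m (sK _) Kx; have Kxd := sgM (sK _) Kx Kd.
have Kxdm := sgX m (sK _) Kxd; have Kxme := sgM (sK _) Kxm Ke1.
have : gammaQ K n.+3 ((x ^+ m * e)^-1 * (x * d) ^+ m).
  by apply: gammaQ_eq_mod; rewrite -Ee gmulfXn conjXg Ed gmulfXn.
move/(sclass0P (S := grQ_sect K n.+2));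
rewrite sclassM ?sclassV //; last exact: (sgV (sK _) Kxme).
rewrite sclassM // (cl0 Ke) addr0 !sclassX // sclassM // mulrnDl.
move=> /(_ (sgM (sK _) (sgV (sK _) Kxme) Kxdm)); rewrite addKr -sclassX //.
move/(sclass0P (S := grQ_sect K n.+2)) => /(_ (sgX m (sK _) Kd)) Kdm.
by apply: gammaQ_isol; exists m.
Qed.

(** By triviality of the action, [G, gammaQ n] is contained in the image of
    gammaQ K n.+1, which is closed under taking roots. *)
Lemma gammaQ_image n : gammaQ G n.+2 `<=` f @` gammaQ K n.+2.
Proof.
elim: n => [|n IH]; first exact: f_gammaQ2.
have sK := @gammaQ_subgroup K.
move=> y Gy; have [x Kx E] := IH y (gammaQ_sub Gy).
exists x => //; apply: gammaQ_isol.
have [m m0 Cy] : isol (commS setT (gammaQ G n.+2)) y by [].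
exists m => //.
have [z Kz Ez] : (f @` gammaQ K n.+3) (y ^+ m).
  move: (y ^+ m) Cy; apply: generated_min; first exact/image_subgroup/sK.
  move=> _ [g [b [_ /IH[a Ka <-] ->]]].
  have [e Ke Ee] := gammaQ_conj_image g Ka.
  exists e^-1; first exact: (sgV (sK _) Ke).
  by rewrite gmulfV -invgR commgEl Ee gmulfM mulKg.
have := @gammaQ_eq_mod n.+3 z (x ^+ m); rewrite gmulfXn E Ez => /(_ erefl).
by move/(sgM (sK _) Kz); rewrite mulVKg.
Qed.

Lemma gammaQ_preimage n x : gammaQ G n.+2 (f x) -> gammaQ K n.+2 x.
Proof.
move=> /gammaQ_image[y Ky E].
have /(sgM (gammaQ_subgroup K _) Ky) := @gammaQ_eq_mod n.+2 _ _ E.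
by rewrite mulVKg.
Qed.

Lemma grQ_iso : exists F : forall n : nat, grQ K n -> grQ G n,
  grQ_induced 2 f F /\ gl_iso_from 2 F.
Proof.
have fN n x : numer (grQ_sect K n) x -> numer (grQ_sect G n) (f x).
  exact: gammaQ_hom.
have fD n x : denom (grQ_sect K n) x -> denom (grQ_sect G n) (f x).
  exact: gammaQ_hom.
pose F n (u : grQ K n) : grQ G n := sect_map (grQ_sect G n) f u.
have FE n x : gammaQ K n x -> F n (grQ_class n x) = grQ_class n (f x).
  exact: (sect_mapE (S := grQ_sect K n) (T := grQ_sect G n) (@fN n) (@fD n)).
exists F; split=> [n x _|]; first exact: FE.
split=> [[|[|n]] // _|m n k e u v _ _].
  split; first exact: (sect_mapD (@fN n.+2) (@fD n.+2)).
  apply: inj_surj_bij.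
    apply: (sect_map_inj (@fN n.+2) (@fD n.+2)) => x _.
    exact: (@gammaQ_preimage n.+1).
  exact/(sect_map_surj (@fN n.+2) (@fD n.+2))/gammaQ_image.
have [x Kx ->] := grQP u; have [y Ky ->] := grQP v.
rewrite [gl_br _ _ _]grQ_brE // !FE //; last by rewrite -e; apply: gammaQ_comm.
by rewrite [RHS]grQ_brE ?gmulfR //; apply: gammaQ_hom.
Qed.

End LowerCentralComparison.

(** * Extensions by torsion-free abelian groups *)

Section AbfExact.
Variables (K G Q : groupType) (iota : groupHom K G) (p : groupHom G Q).
Hypothesis exact_iota_p : abf_exact iota p.
Hypotheses (Qab : forall x y : Q, commute x y) (Qtf : torsion_free Q).

Lemma abf_exact_inj : injective iota.
Proof. by case: exact_iota_p => -[]. Qed.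

(** This is left exactness on torsion-free abelianizations. *)
Lemma derivedQ1_preimage x : derivedQ1 G (iota x) -> derivedQ1 K x.
Proof.
case: exact_iota_p => _ [inj_abf _ _] Dx.
have : qclass (derivedQ1_normal K) x = qclass (derivedQ1_normal K) 1.
  apply: inj_abf; rewrite [LHS]quotg_mapE [RHS]quotg_mapE.
  by apply/qclass_eqP; rewrite gmulf1 divg1.
by move/qclass_eqP; rewrite divg1.
Qed.

(** G / K = Q is abelian and torsion-free, so the roots of G' lie in K. *)
Lemma derivedQ1_image : derivedQ1 G `<=` iota @` derivedQ1 K.
Proof.
move=> y Dy; case: exact_iota_p => -[_ im_iota _] _.
have : range iota y.
  rewrite im_iota; case: Dy => m m0 Dm; apply: (Qtf m0); rewrite -gmulfXn.
  move: (y ^+ m) Dm; apply: generated_min.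
    by split=> [|u v] /=; rewrite ?gmulf1 // gmulfF => -> ->; rewrite divgg.
  by move=> _ [u [v [_ _ ->]]] /=; rewrite gmulfR; apply/eqP/commgP/Qab.
by move=> [x _ E]; exists x => //; apply: derivedQ1_preimage; rewrite E.
Qed.

(** A root of an element of derivedQ2 K lies in derivedQ1 G = iota (derivedQ1 K),
    hence in K. *)
Lemma derivedQ2_image : derivedQ2 G `<=` iota @` derivedQ2 K.
Proof.
move=> y Dy; have [x Dx E] := derivedQ1_image (derivedQ2_sub Dy).
exists x => //; case: Dy => m m0 Dm; exists m => //.
have [z Cz Ez] : (iota @` commS (derivedQ1 K) (derivedQ1 K)) (y ^+ m).
  move: (y ^+ m) Dm; apply: generated_min.
    exact/image_subgroup/commS_subgroup.
  move=> _ [u [v [/derivedQ1_image[a Da <-] /derivedQ1_image[b Db <-] ->]]].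
  by exists [~ a, b]; [exact: mem_commS|exact: gmulfR].
suff -> : x ^+ m = z by [].
by apply: abf_exact_inj; rewrite gmulfXn E Ez.
Qed.

Lemma derivedQ2_preimage x : derivedQ2 G (iota x) -> derivedQ2 K x.
Proof. by move=> /derivedQ2_image[y Dy /abf_exact_inj <-]. Qed.

Lemma derivedQ2_hom x : derivedQ2 K x -> derivedQ2 G (iota x).
Proof.
by apply: isol_hom; apply: commS_hom; apply: (derivedQ1_hom iota).
Qed.

Let hN x : numer (BQ_sect K) x -> numer (BQ_sect G) (iota x) :=
  @derivedQ1_hom _ _ iota x.
Let hD x : denom (BQ_sect K) x -> denom (BQ_sect G) (iota x) :=
  @derivedQ2_hom x.

Definition BQ_map (u : BQ K) : restrict (BQ G) (zgmap (abf_map iota)) :=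
  sect_map (BQ_sect G) iota u.

Lemma BQ_mapE x : derivedQ1 K x -> BQ_map (BQ_class x) = BQ_class (iota x).
Proof. exact: (sect_mapE (S := BQ_sect K) (T := BQ_sect G) hN hD). Qed.

Fact BQ_map_zmod : zmod_morphism BQ_map.
Proof.
move=> u v; apply/eqP; rewrite eq_sym subr_eq -(sect_mapD hN hD); apply/eqP.
by rewrite subrK.
Qed.

Fact BQ_map_scalable : scalable BQ_map.
Proof.
move=> z u; move: z; apply: (zg_ext (V := BQ G)) => [z z'|z z'|a].
- by rewrite scalerBl BQ_map_zmod.
- by rewrite scalerBl.
have [x Dx ->] := BQP u; rewrite -[a]qclassK; set g := repr a.
rewrite [RHS]/(zgmap _ _ *: (_ : BQ G))%R zgmapU.
rewrite [X in BQ_map X]BQ_scaleU [RHS]BQ_scaleU BQ_mapE //.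
rewrite [abf_map _ _]quotg_mapE !BQ_conjE //; last exact: (derivedQ1_hom iota).
rewrite BQ_mapE ?gmulfJ ?gmulfV //; exact: derivedQ1_conj.
Qed.

HB.instance Definition _ :=
  GRing.isZmodMorphism.Build (BQ K) (restrict (BQ G) (zgmap (abf_map iota)))
    BQ_map BQ_map_zmod.
HB.instance Definition _ :=
  GRing.isScalable.Build (zgring (abf K)) (BQ K)
    (restrict (BQ G) (zgmap (abf_map iota))) *:%R%R BQ_map BQ_map_scalable.

Lemma BQ_iso :
  exists f : {linear BQ K -> restrict (BQ G) (zgmap (abf_map iota))},
    (forall x : K, derivedQ1 K x -> f (BQ_class x) = BQ_class (iota x)) /\
    bijective f.
Proof.
exists BQ_map; split; first exact: BQ_mapE.
apply: inj_surj_bij.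
  by apply: (sect_map_inj hN hD) => x _; apply: derivedQ2_preimage.
exact/(sect_map_surj hN hD)/derivedQ1_image.
Qed.

Lemma abf_exact_gammaQ2 : gammaQ G 2 `<=` iota @` gammaQ K 2.
Proof. exact: derivedQ1_image. Qed.

Lemma abf_exact_ker n x : iota x = 1 -> gammaQ K n x.
Proof.
move=> E; have -> : x = 1 by apply: abf_exact_inj; rewrite E gmulf1.
exact: (gammaQ_subgroup K n).1.
Qed.

Lemma derived1_metab (H : groupType) :
  derived1 (metab H) `<=` qclass (derived2_normal H) @` derived1 H.
Proof.
apply: generated_min; first exact/(image_subgroup (qclass _))/commS_subgroup.
move=> _ [u [v [_ _ ->]]]; rewrite -[u]qclassK -[v]qclassK -gmulfR.
by eexists; last reflexivity; apply: mem_commS.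
Qed.

Lemma derived2_metab (H : groupType) : derived2 (metab H) `<=` [set 1].
Proof.
apply: generated_min; first by split=> // _ _ -> ->; rewrite divgg.
move=> _ [_ [_ [/derived1_metab[x Dx <-] /derived1_metab[y Dy <-] ->]]].
rewrite -gmulfR; change (qclass (derived2_normal H) [~ x, y] = qclass _ 1).
by apply/qclass_eqP; rewrite divg1; apply: mem_commS.
Qed.

Lemma metab_gammaQ2 :
  gammaQ (metab G) 2 `<=` metab_map iota @` gammaQ (metab K) 2.
Proof.
move=> u [m m0]; rewrite -[u]qclassK; set g := repr u.
rewrite -gmulfXn => /derived1_metab[y Dy /qclass_eqP D2].
have [x Dx E] : (iota @` derivedQ1 K) g.
  apply: derivedQ1_image; exists m => //.
  have sD := commS_subgroup (@setT G) setT.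
  have /(sgV sD) : derived1 G (y / g ^+ m).
    by apply: commS_subl D2; [exact: sD|exact: derived1_conj].
  by rewrite invgF => /(sgM sD)/(_ Dy); rewrite mulgVK.
exists (qclass _ x); last by rewrite [LHS]quotg_mapE E.
exact: (gammaQ_hom (qclass (derived2_normal K)) (n := 2)).
Qed.

(** G'' lies in derivedQ2 G = iota (derivedQ2 K), so the kernel comes from
    derivedQ2 K, whose image in the metabelian group K/K'' lies in every term of
    the rational lower central series. *)
Lemma metab_ker n u : metab_map iota u = 1 -> gammaQ (metab K) n u.
Proof.
rewrite -[u]qclassK; set x := repr u; rewrite [LHS]quotg_mapE => /qclass_eqP.
rewrite divg1 => D2x; apply: derivedQ2_gammaQ; first exact: derived2_metab.
have : derivedQ2 K x.
  apply: derivedQ2_preimage; apply: sub_isol; move: (iota x) D2x => {x u}.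
  by move=> y; apply: (commS_hom (f := idfun)) => z; apply: sub_isol.
apply: (isol_hom (f := qclass (derived2_normal K))) => y.
by apply: commS_hom => z; apply: (derivedQ1_hom (qclass (derived2_normal K))).
Qed.

End AbfExact.

(** * Rational vector spaces *)

Section RationalDimension.
Local Open Scope ring_scope.
Implicit Types V W : lmodType rat.

Lemma lspan0 V (X : set V) : lspan X 0.
Proof. exact/set_mem/(lspan_submod X).1. Qed.

Lemma lspan_lin V (X : set V) a u v :
  lspan X u -> lspan X v -> lspan X (a *: u + v).
Proof. by move=> Xu Xv; apply/set_mem/(lspan_submod X).2; apply/mem_set. Qed.

Lemma lspanZ V (X : set V) a u : lspan X u -> lspan X (a *: u).
Proof.
by move=> Xu; rewrite -[_ *: _]addr0; apply: lspan_lin => //; apply: lspan0.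
Qed.

Lemma lspanD V (X : set V) u v : lspan X u -> lspan X v -> lspan X (u + v).
Proof. by move=> Xu Xv; rewrite -[u]scale1r; apply: lspan_lin. Qed.

Lemma lspanN V (X : set V) u : lspan X u -> lspan X (- u).
Proof. by rewrite -scaleN1r; apply: lspanZ. Qed.

Lemma lspan_ind V (X W : set V) : W 0 ->
  (forall a u v, W u -> W v -> W (a *: u + v)) -> X `<=` W -> lspan X `<=` W.
Proof.
move=> W0 WL; apply: lspan_min; split; first exact/mem_set.
by move=> a u v /set_mem Wu /set_mem Wv; apply/mem_set/WL.
Qed.

Lemma lspan_linear V W (f : {linear V -> W}) (X : set V) (Y : set W) :
  (forall x, X x -> lspan Y (f x)) -> forall v, lspan X v -> lspan Y (f v).
Proof.
move=> XY; apply: (@lspan_ind _ _ [set v | lspan Y (f v)]) => [||x /XY //].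
  by rewrite /mkset linear0; apply: lspan0.
by move=> a u v Yu Yv; rewrite /mkset linearP; apply: lspan_lin.
Qed.

Definition to_linear V W (f : V -> W) (fL : linear f) : {linear V -> W} :=
  HB.pack f (GRing.isLinear.Build _ _ _ _ f fL).

Lemma bij_linear_inv V W (f : {linear V -> W}) : bijective f ->
  exists2 g : {linear W -> V}, cancel f g & cancel g f.
Proof. by move=> [g fK gK]; exists (to_linear (can2_linear fK gK)). Qed.

Definition fin_span V : Prop := exists s : seq V, forall v, lspan [set` s] v.

Lemma fin_span_surj V W (f : {linear V -> W}) :
  (forall w, exists v, f v = w) -> fin_span V -> fin_span W.
Proof.
move=> f_surj [s sV]; exists (map f s) => w; have [v <-] := f_surj w.
apply: lspan_linear (sV v) => x /= sx; apply: lspan_sub.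
by rewrite /= map_f.
Qed.

Lemma fin_dimQ_span V : fin_dimQ V -> fin_span V.
Proof.
move=> [d [f /bij_linear_inv[g fK gK]]].
apply: (@fin_span_surj _ _ g) => [w|]; first by exists (f w); apply: fK.
exists (codom (fun j : 'I_d => delta_mx 0 j)) => v; rewrite (row_sum_delta v).
elim/big_ind: _ => [|x y|i _]; [exact: lspan0|exact: lspanD|].
by apply: lspanZ; apply: lspan_sub; apply: codom_f.
Qed.

(** A linear relation expresses one of the vectors by the others, so a family
    of least size is a basis. *)
Lemma family_fin_dimQ V k (v : 'I_k -> V) :
  (forall u, exists c : 'rV[rat]_k, u = \sum_i c 0 i *: v i) -> fin_dimQ V.
Proof.
elim: k v => [|k IH] v v_span.
all: pose comb (c : 'rV[rat]__) := \sum_i c 0 i *: v i.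
all: have combL : linear comb
  by move=> a c d; rewrite scaler_sumr -big_split; apply: eq_bigr => i _;
     rewrite !mxE scalerDl scalerA.
all: pose C := to_linear combL.
  have Cb : bijective C.
    apply: inj_surj_bij => [c d _|u]; first by apply/rowP => -[].
    by have [c ->] := v_span u; exists c.
  by have [g gK Cg] := bij_linear_inv Cb; exists 0%N, g; exists C.
have [[c cv c0]|inj] := pselect (exists2 c, comb c = 0 & c != 0); last first.
  have Cb : bijective C.
    apply: inj_surj_bij => [c d E|u].
      apply/eqP; rewrite -subr_eq0; apply/negPn/negP => cd; apply: inj.
      by exists (c - d) => //; move/eqP: E; rewrite -subr_eq0 -linearB => /eqP.
    by have [c ->] := v_span u; exists c.
  by have [g gK Cg] := bij_linear_inv Cb; exists k.+1, g; exists C.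
have /rV0Pn[i ci] := c0; apply: (IH (fun j => v (lift i j))) => u.
have [d ->] := v_span u; rewrite (bigD1_ord i) //=.
have vi : v i = - (c 0 i)^-1 *: \sum_(j < k) c 0 (lift i j) *: v (lift i j).
  move: cv; rewrite /comb (bigD1_ord i) //= => /eqP.
  rewrite addr_eq0 => /eqP; move/(congr1 (fun x => (c 0 i)^-1 *: x)).
  by rewrite scalerA mulVf // scale1r scalerN scaleNr.
exists (\row_j (d 0 (lift i j) - d 0 i / c 0 i * c 0 (lift i j))).
rewrite vi !scalerA scaler_sumr -big_split; apply: eq_bigr => j _ /=.
by rewrite !mxE scalerA -scalerDl addrC mulrN mulNr.
Qed.

Lemma fin_span_dimQ V : fin_span V -> fin_dimQ V.
Proof.
move=> [s sV]; apply: (@family_fin_dimQ V (size s) (fun i => s`_i)) => u.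
have : lspan [set` s] u by [].
move: u; apply: lspan_ind => [|a _ _ [c ->] [d ->]|v /= /(nthP 0)[i si <-]].
- by exists 0; rewrite big1 // => i _; rewrite mxE scale0r.
- exists (a *: c + d); rewrite scaler_sumr -big_split; apply: eq_bigr => i _.
  by rewrite !mxE scalerDl scalerA.
exists (delta_mx 0 (Ordinal si)); rewrite (bigD1 (Ordinal si)) //= !mxE !eqxx.
by rewrite scale1r big1 ?addr0 // => j /negPf ji; rewrite mxE ji scale0r.
Qed.

Lemma row_linear_inj_leq m n (f : {linear 'rV[rat]_m -> 'rV[rat]_n}) :
  injective f -> (m <= n)%N.
Proof.
move=> injf; have : row_free (lin1_mx f).
  rewrite -kermx_eq0; apply/eqP/row_matrixP => i; rewrite row0; apply: injf.
  by rewrite linear0 -mul_rV_lin1 -row_mul mulmx_ker row0.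
by move/eqP <-; apply: rank_leq_col.
Qed.

Lemma has_dimQ_leq V W (f : {linear V -> W}) m n :
  injective f -> has_dimQ V m -> has_dimQ W n -> (m <= n)%N.
Proof.
move=> injf [g /bij_linear_inv[g' gK g'K]] [h /bij_inj injh].
apply: (@row_linear_inj_leq _ _ (h \o f \o g' : {linear _ -> _})).
by move=> x y /injh/injf /(can_inj g'K).
Qed.

Lemma has_dimQ_dimQ V d : has_dimQ V d -> dimQ V = d.
Proof.
move=> dV; rewrite /dimQ; case: xgetP => [e _ eV|/(_ d) //].
have idi : injective (idfun : {linear V -> V}) by [].
by apply/eqP; rewrite eqn_leq (has_dimQ_leq idi eV dV) (has_dimQ_leq idi dV eV).
Qed.

Lemma has_dimQ_bij V W (f : {linear V -> W}) d :
  bijective f -> has_dimQ W d -> has_dimQ V d.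
Proof.
by move=> bf [g bg]; exists (g \o f : {linear V -> _}); apply: bij_comp.
Qed.

Lemma fin_dimQ_bij V W (f : {linear V -> W}) : bijective f ->
  fin_dimQ W -> fin_dimQ V /\ dimQ V = dimQ W.
Proof.
move=> bf [d dW]; have dV := has_dimQ_bij bf dW.
by split; [exists d|rewrite (has_dimQ_dimQ dV) (has_dimQ_dimQ dW)].
Qed.

(** A largest independent family in the image of f is a basis of the image. *)
Lemma fin_dimQ_inj V W (f : {linear V -> W}) : injective f ->
  fin_dimQ W -> fin_dimQ V /\ (dimQ V <= dimQ W)%N.
Proof.
move=> injf fW; suff fV : fin_dimQ V.
  split=> //; have [[m mV] [n nW]] := (fV, fW).
  rewrite (has_dimQ_dimQ mV) (has_dimQ_dimQ nW).
  exact: (has_dimQ_leq injf mV nW).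
have [d [g /bij_inj injg]] := fW.
pose h : {linear V -> _} := g \o f.
have injh : injective h by move=> x y /injg/injf.
pose indep k := `[< exists2 M : 'M[rat]_(k, d), row_free M &
                    forall i, exists v, h v = row i M >].
have ex : exists k, indep k.
  by exists 0%N; apply/asboolP; exists 0; [rewrite /row_free mxrank0|case].
have ub k : indep k -> (k <= d)%N.
  by move=> /asboolP[M /eqP fM _]; rewrite -{1}fM; apply: rank_leq_col.
case: (ex_maxnP ex ub) => k /asboolP[M freeM rowM] maxk.
have hM v : (h v <= M)%MS.
  apply/negPn/negP => hvM.
  have /maxk : indep (1 + k)%N; last by rewrite add1n ltnn.
  apply/asboolP; exists (col_mx (h v) M : 'M_(1 + k, d)).
    have : (\rank M < \rank (col_mx (h v) M))%N.
      have /ltn_leqif -> :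
          (\rank M <= \rank (col_mx (h v) M) ?= iff (col_mx (h v) M <= M)%MS)%N.
        by apply: mxrank_leqif_sup; rewrite -addsmxE addsmxSr.
      by rewrite col_mx_sub negb_and hvM.
    by rewrite (eqP freeM) /row_free eqn_leq rank_leq_row.
  move=> i; rewrite -[i]splitK; case: (split i) => j /=.
    by exists v; rewrite rowKu; apply/rowP => l; rewrite mxE ord1.
  by rewrite rowKd.
pose c v := h v *m pinvmx M.
have cL : linear c by move=> a u v; rewrite /c linearP mulmxDl scalemxAl.
exists k, (to_linear cL); apply: inj_surj_bij => [u v E|r].
  apply: injh; rewrite -(mulmxKpV (hM u)) -(mulmxKpV (hM v)).
  by congr (_ *m _).
have [v hv] : exists v, h v = r *m M.
  rewrite mulmx_sum_row; elim/big_ind: _ => [|_ _ [a <-] [b <-]|i _].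
  - by exists 0; rewrite linear0.
  - by exists (a + b); rewrite linearD.
  by have [a <-] := rowM i; exists (r 0 i *: a); rewrite linearZ.
by exists v; rewrite /= /c hv mulmxKp.
Qed.

Lemma malg_lift (T : choiceType) (V : lmodType rat) (h : T -> V) :
  exists L : {linear {malg rat[T]} -> V}, forall k, L << k >> = h k.
Proof.
pose L (g : {malg rat[T]}) : V := \sum_(k <- msupp g) g@_k *: h k.
have LE g (d : {fset T}) : fsubset (msupp g) d -> L g = \sum_(k <- d) g@_k *: h k.
  move=> le; rewrite /L (big_fset_incl _ le) // => k _ /mcoeff_outdom ->.
  by rewrite scale0r.
have LL : linear L.
  move=> a u v; pose d := (msupp (a *: u + v) `|` (msupp u `|` msupp v))%fset.
  rewrite (LE _ d) ?fsubsetUl // (LE u d); last by rewrite /d fsetUCA fsubsetUl.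
  rewrite (LE v d); last by rewrite /d fsetUA fsubsetUr.
  rewrite scaler_sumr -big_split; apply: eq_bigr => k _.
  by rewrite /= mcoeffD mcoeffZ scalerDl scalerA.
exists (to_linear LL) => k; rewrite /= (LE _ _ msuppU_le) big_seq_fset1.
by rewrite mcoeffUU scale1r.
Qed.

Lemma quotv_lift (V W : lmodType rat) (X : set V) (L : {linear V -> W}) :
    (forall x, X x -> L x = 0) ->
  exists F : {linear quotv X -> W}, forall v, F (quotv_pi X v) = L v.
Proof.
move=> LX; pose F (t : quotv X) := L (repr t).
have FE v : F (quotv_pi X v) = L v.
  apply/eqP; rewrite -subr_eq0 -linearB; apply/eqP.
  have /quotv_piP : quotv_pi X (repr (quotv_pi X v)) = quotv_pi X v.
    exact: quotv_reprK.
  apply: (@lspan_ind _ _ [set w | L w = 0]) => [|a u w|//].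
    by rewrite /mkset linear0.
  by rewrite /mkset linearP => -> ->; rewrite scaler0 addr0.
have FL : linear F.
  move=> a u v; rewrite -[u]quotv_reprK -[v]quotv_reprK.
  by rewrite [_ *: _]quotv_scaleE -quotv_piD !FE linearP.
by exists (to_linear FL).
Qed.

End RationalDimension.

(** * Rationalization of abelian groups *)

Section Rationalization.
Local Open Scope ring_scope.

Lemma morphD_zmod (U V : zmodType) (h : U -> V) :
  {morph h : x y / x + y} -> zmod_morphism h.
Proof.
move=> hD x y; apply/eqP; rewrite eq_sym subr_eq -hD; apply/eqP.
by rewrite subrK.
Qed.

Definition to_additive (U V : zmodType) (h : U -> V)
    (hD : {morph h : x y / x + y}) : {additive U -> V} :=
  HB.pack h (GRing.isZmodMorphism.Build U V h (morphD_zmod hD)).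

Section OneGroup.
Variable A : zmodType.
Implicit Types (a b : A) (t : tensorQ A).

HB.instance Definition _ :=
  GRing.isZmodMorphism.Build A (tensorQ A) (@tensorQ_in A)
    (morphD_zmod (@tensorQ_inD A)).

Lemma tensorQ_lift (V : lmodType rat) (h : A -> V) : {morph h : x y / x + y} ->
  exists F : {linear tensorQ A -> V}, forall a, F (tensorQ_in a) = h a.
Proof.
move=> hD; have [F [[FL FE] _]] := tensorQ_universal (to_additive hD).
by exists (to_linear FL).
Qed.

Lemma tensorQ_span t : lspan (range (@tensorQ_in A)) t.
Proof.
rewrite -(quotv_reprK t) (monalgE (repr t)).
elim: (enum_fset _) => [|k s IH].
  by rewrite big_nil [quotv_pi _ 0]raddf0; apply: lspan0.
rewrite big_cons quotv_piD; apply: lspanD => //.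
have -> : << (repr t)@_k *g k >> = (repr t)@_k *: << k >> :> {malg rat[A]}.
  by apply/malgP=> j; rewrite mcoeffZ !mcoeffU mulrnAr mulr1.
by rewrite -quotv_scaleE; apply: lspanZ; apply: lspan_sub; exists k.
Qed.

Lemma ratZ_denq (V : lmodType rat) (q : rat) (v : V) :
  q *: v *+ `|denq q| = v *~ numq q.
Proof.
rewrite -scaler_nat scalerA -scaler_int; congr (_ *: _).
by rewrite numqE mulrC -[in RHS]absz_denq.
Qed.

Lemma clear_denominators (V : lmodType rat) (q : rat) (u v : V) m n :
  (q *: u + v) *+ (`|denq q| * (m * n)) =
  u *+ m *+ n *~ numq q + v *+ n *+ (m * `|denq q|).
Proof.
rewrite mulrnDl mulrnA ratZ_denq mulrnA [LHS]addrC [RHS]addrC; congr (_ + _).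
  rewrite -!mulrnA; congr (_ *+ _).
  by rewrite !mulnA [RHS]mulnC !mulnA mulnAC [(_ * m)%N]mulnC.
by rewrite -!scaler_int -!scaler_nat !scalerA; congr (_ *: _); rewrite mulrC mulrA.
Qed.

Lemma absz_denq_gt0 (q : rat) : (0 < `|denq q|)%N.
Proof. by rewrite absz_gt0 denq_neq0. Qed.

(** Finitely many rational coefficients have a common denominator. *)
Lemma tensorQ_pure t : exists2 m, (0 < m)%N & exists a, t *+ m = tensorQ_in a.
Proof.
move: t (tensorQ_span t); apply: lspan_ind => [|q u v|_ [a _ <-]].
- by exists 1%N => //; exists 0; rewrite raddf0.
- move=> [m m0 [a Ea]] [n n0 [b Eb]].
  exists (`|denq q| * (m * n))%N; first by rewrite !muln_gt0 absz_denq_gt0 m0.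
  exists (a *+ n *~ numq q + b *+ (m * `|denq q|)).
  rewrite clear_denominators Ea Eb.
  rewrite (raddfD (@tensorQ_in A)) (raddfMz (@tensorQ_in A)).
  by rewrite !(raddfMn (@tensorQ_in A)).
by exists 1%N => //; exists a.
Qed.

Lemma tensorQ_in_torsion a m : (0 < m)%N -> a *+ m = 0 -> tensorQ_in a = 0.
Proof.
move=> m0 am; have : (m%:R : rat) *: tensorQ_in a = 0.
  by rewrite scaler_nat -raddfMn am raddf0.
move/eqP; rewrite scaler_eq0 pnatr_eq0 => /orP[/eqP m_0|/eqP //].
by rewrite m_0 in m0.
Qed.

(** A rational combination of the defining relations, cleared of denominators, is
    a combination of the relations with integral coefficients, which the
    evaluation in A of integral formal sums kills. *)
Lemma tensorQ_in_eq0 a : tensorQ_in a = 0 -> exists2 m, (0 < m)%N & a *+ m = 0.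
Proof.
pose toQ : {malg int[A]} -> {malg rat[A]} := zlift (fun b => << b >>).
have toQE z k : (toQ z)@_k = (z@_k)%:~R.
  pose f1 : {additive {malg int[A]} -> rat} := mcoeff k \o toQ.
  pose f2 : {additive {malg int[A]} -> rat} := intr \o mcoeff k.
  apply: (@malg_additive_ext _ _ f1 f2) => j.
  by rewrite /f1 /f2 /= /toQ zliftU mulr1z !mcoeffU; case: (j == k).
have toQ_inj : injective toQ.
  move=> z z' E; apply/malgP => k; apply: (@intr_inj rat).
  by rewrite -!toQE E.
move=> a0; have : lspan (@tensorQ_rel A) (<< a >> - 0).
  by apply/quotv_piP; rewrite [RHS]raddf0.
rewrite subr0 => La.
pose W (w : {malg rat[A]}) := exists2 m, (0 < m)%N &
  exists2 z : {malg int[A]}, toQ z = w *+ m & zlift id z = 0.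
have [m m0 [z Ez z0]] : W << a >>.
  apply: (@lspan_ind _ _ W _ _ _ _ La) => [|q u v|w].
  - by exists 1%N => //; exists 0; rewrite /toQ raddf0.
  - move=> [m m0 [x Ex x0]] [n n0 [y Ey y0]].
    exists (`|denq q| * (m * n))%N; first by rewrite !muln_gt0 absz_denq_gt0 m0.
    exists (x *+ n *~ numq q + y *+ (m * `|denq q|)); last first.
      by rewrite raddfD raddfMz !raddfMn /= x0 y0 !mul0rn mul0rz addr0.
    by rewrite clear_denominators -Ex -Ey /toQ raddfD raddfMz !raddfMn.
  move=> [x _ [y _ <-]]; exists 1%N => //.
  exists (<< x + y >> - << x >> - << y >>).
    by rewrite /toQ !raddfB /= !zliftU !mulr1z.
  by rewrite !raddfB /= !zliftU !mulr1z addrAC addrK subrr.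
exists m => //; rewrite -[RHS]z0; have -> : z = << a >> *+ m.
  by apply: toQ_inj; rewrite Ez /toQ raddfMn /= zliftU mulr1z.
by rewrite raddfMn /= zliftU mulr1z.
Qed.

Lemma fin_span_tensorQ (s : seq A) :
    (forall a, lspan (@tensorQ_in A @` [set` s]) (tensorQ_in a)) ->
  fin_span (tensorQ A).
Proof.
move=> sA; exists (map (@tensorQ_in A) s) => t.
have sub u : lspan (@tensorQ_in A @` [set` s]) u ->
    lspan [set` map (@tensorQ_in A) s] u.
  apply: (lspan_linear (f := idfun)) => _ [a sa <-]; apply: lspan_sub.
  by rewrite /= map_f.
have [m m0 [a E]] := tensorQ_pure t.
have -> : t = m%:R^-1 *: tensorQ_in a.
  by rewrite -E -scaler_nat scalerA mulVf ?scale1r // pnatr_eq0 -lt0n.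
by apply: lspanZ; apply: sub.
Qed.

Lemma tensorQ_fin_span : fin_span (tensorQ A) ->
  exists s : seq A, forall t, lspan (@tensorQ_in A @` [set` s]) t.
Proof.
move=> [s sV]; have /choice[f fE] : forall t, exists a,
    exists2 m, (0 < m)%N & t *+ m = tensorQ_in a.
  by move=> t; have [m m0 [a E]] := tensorQ_pure t; exists a, m.
exists (map f s) => t; move: (sV t).
apply: (lspan_linear (f := idfun)) => u su; have [m m0 E] := fE u.
rewrite -[X in lspan _ X](@scalerK _ _ m%:R) ?pnatr_eq0 -?lt0n // scaler_nat E.
by apply: lspanZ; apply: lspan_sub; exists (f u) => //=; rewrite map_f.
Qed.

End OneGroup.

Section Map.
Variables (A B : zmodType) (h : A -> B).
Hypothesis hD : {morph h : x y / x + y}.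

Lemma tensorQ_map : exists F : {linear tensorQ A -> tensorQ B},
  forall a, F (tensorQ_in a) = tensorQ_in (h a).
Proof.
apply: (tensorQ_lift (h := fun a => tensorQ_in (h a))) => x y.
by rewrite hD raddfD.
Qed.

Variable F : {linear tensorQ A -> tensorQ B}.
Hypothesis FE : forall a, F (tensorQ_in a) = tensorQ_in (h a).

Lemma tensorQ_map_inj :
    (forall a, h a = 0 -> exists2 m, (0 < m)%N & a *+ m = 0) -> injective F.
Proof.
move=> ker_h; apply: raddf_inj => t Ft; have [m m0 [a E]] := tensorQ_pure t.
have /tensorQ_in_eq0[n n0] : tensorQ_in (h a) = 0.
  by rewrite -FE -E raddfMn Ft mul0rn.
rewrite -[h]/(to_additive hD : A -> B) -raddfMn => /ker_h[k k0 ak].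
have ta : tensorQ_in a = 0.
  by apply: (@tensorQ_in_torsion _ _ (n * k)); rewrite ?muln_gt0 ?n0 // mulrnA.
move/eqP: E; rewrite ta -scaler_nat scaler_eq0 pnatr_eq0.
move=> /orP[/eqP m_0|/eqP //].
by rewrite m_0 in m0.
Qed.

Lemma tensorQ_map_surj :
    (forall b, exists2 m, (0 < m)%N & exists a, h a = b *+ m) ->
  forall u, exists t, F t = u.
Proof.
move=> coker_h u; have [m m0 [b E]] := tensorQ_pure u.
have [n n0 [a Ea]] := coker_h b.
have Ebn : tensorQ_in (b *+ n) = u *+ (m * n) by rewrite raddfMn mulrnA E.
exists ((m * n)%:R^-1 *: tensorQ_in a).
rewrite linearZ /= FE Ea Ebn -scaler_nat scalerA mulVf ?scale1r //.
by rewrite pnatr_eq0 -lt0n muln_gt0 m0.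
Qed.

End Map.
End Rationalization.

(** * Rational associated graded spaces *)

Section GradedMap.
Variables (K G : groupType) (f : groupHom K G) (n : nat).

Lemma gr_tensorQ_map : exists F : {linear gr_tensorQ n K -> gr_tensorQ n G},
  ((forall x, gamma K n x -> gamma G n.+1 (f x) -> isol (gamma K n.+1) x) ->
     injective F) /\
  ((forall y, gamma G n y ->
      exists2 m, (0 < m)%N & (f @` gamma K n) (y ^+ m)) ->
     forall u, exists t, F t = u).
Proof.
have hN x : numer (gr_sect K n) x -> numer (gr_sect G n) (f x).
  by exact: gamma_hom.
have hD x : denom (gr_sect K n) x -> denom (gr_sect G n) (f x).
  by exact: gamma_hom.
have hMD := sect_mapD hN hD; have hE := sect_mapE hN hD.
have [F FE] := tensorQ_map hMD; exists F; split=> [cond|cond].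
  apply: (tensorQ_map_inj hMD FE) => u; rewrite -[u]sreprK.
  have Nu := srepr_numer u; rewrite hE // => /(sclass0P (S := gr_sect G n)).
  move=> /(_ (hN _ Nu))/(cond _ Nu)[m m0 Dm]; exists m => //.
  rewrite -sclassX //; apply/(sclass0P (S := gr_sect K n)) => //.
  exact: (sgX _ (numer_subgroup (gr_sect K n)) Nu).
apply: (tensorQ_map_surj FE) => v; rewrite -[v]sreprK; have Nv := srepr_numer v.
have [m m0 [x Kx E]] := cond _ Nv; exists m => //.
by exists (sclass _ x); rewrite hE // E sclassX.
Qed.

End GradedMap.

Lemma gamma_image (G H : groupType) (f : groupHom G H) n :
  (forall y, exists x, f x = y) -> gamma H n `<=` f @` gamma G n.
Proof.
move=> f_surj; elim: n => [|[|n] IH] y.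
- by have [x <-] := f_surj y; exists x.
- by have [x <-] := f_surj y; exists x.
apply: generated_min; first exact/image_subgroup/gamma_subgroup.
move=> _ [a [b [_ /IH[z Gz <-] ->]]]; have [x <-] := f_surj a.
by exists [~ x, z]; [apply: gamma_commT|rewrite gmulfR].
Qed.

Lemma gr_fin_span_surj (G H : groupType) (f : groupHom G H) n :
  (forall y, exists x, f x = y) ->
  fin_span (gr_tensorQ n G) -> fin_span (gr_tensorQ n H).
Proof.
move=> f_surj; have [F [_ F_surj]] := gr_tensorQ_map f n.
apply: (fin_span_surj (f := F)); apply: F_surj => y.
move=> /(gamma_image f_surj)[x Gx <-].
by exists 1%N => //; exists x.
Qed.

Section GradedComparison.
Variables (K G : groupType) (f : groupHom K G).
Hypothesis f_gammaQ2 : gammaQ G 2 `<=` f @` gammaQ K 2.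
Hypothesis f_ker : forall n x, f x = 1 -> gammaQ K n x.

(** Every element of gammaQ n has a power in gamma n, so the equality of the
    rational lower central series gives gr_n K -> gr_n G torsion kernel and
    cokernel. *)
Lemma gr_tensorQ_dim n : fin_dimQ (gr_tensorQ n.+2 G) ->
  fin_dimQ (gr_tensorQ n.+2 K) /\
  dimQ (gr_tensorQ n.+2 K) = dimQ (gr_tensorQ n.+2 G).
Proof.
have [F [F_inj F_surj]] := gr_tensorQ_map f n.+2.
apply: (fin_dimQ_bij (f := F)); apply: inj_surj_bij.
  apply: F_inj => x _ /gamma_gammaQ.
  by move=> /(@gammaQ_preimage _ _ _ f_gammaQ2 f_ker n.+1); rewrite gammaQE.
apply: F_surj => y /gamma_gammaQ/(gammaQ_image f_gammaQ2 f_ker)[x].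
rewrite gammaQE => -[m m0 Kx] <-; exists m => //.
by exists (x ^+ m); rewrite ?gmulfXn.
Qed.

Lemma gr1_tensorQ_dim : fin_dimQ (gr_tensorQ 1 G) ->
  fin_dimQ (gr_tensorQ 1 K) /\
  (dimQ (gr_tensorQ 1 K) <= dimQ (gr_tensorQ 1 G))%N.
Proof.
have [F [F_inj _]] := gr_tensorQ_map f 1.
apply: (fin_dimQ_inj (f := F)); apply: F_inj => x _ /gamma_gammaQ.
by move=> /(@gammaQ_preimage _ _ _ f_gammaQ2 f_ker 0); rewrite gammaQE.
Qed.

End GradedComparison.

Section GradedGeneration.
Variable G : groupType.

Local Notation T n := (gr_tensorQ n G).

Definition gr_in n (x : G) : T n := tensorQ_in (sclass (gr_sect G n) x).

Let gs := @gamma_subgroup G.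

(** A homomorphism to an abelian group kills gamma 2. Applied to g |-> [g, x] this
    makes the bracket factor through gr_1 in its first argument, with no need to
    locate [gamma 2, gamma n] in the lower central series. *)
Lemma gr1_lift (V : lmodType rat) (h : G -> V) :
    {morph h : x y / x * y >-> (x + y)%R} ->
  exists F : {linear T 1 -> V}, forall x, F (gr_in 1 x) = h x.
Proof.
move=> hM; have h1 : h 1 = 0%R.
  by apply: (@addrI _ (h 1)); rewrite -hM mulg1 addr0.
have hV x : h x^-1 = (- h x)%R by apply/eqP; rewrite -addr_eq0 -hM mulVg h1.
have h2 : gamma G 2 `<=` [set x | h x = 0%R].
  apply: generated_min.
    by split=> [|x y] //=; rewrite hM hV => -> ->; rewrite subr0.
  move=> _ [x [y [_ _ ->]]] /=.
  by rewrite /commg /conjg !hM !hV [(h x + h y)%R]addrC addKr addNr.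
have N1 x : numer (gr_sect G 1) x by [].
have hE x : h (srepr (sclass (gr_sect G 1) x)) = h x.
  have /h2 := srepr_class (N1 x).
  by rewrite /= hM hV => /eqP; rewrite subr_eq0 => /eqP.
have hD : {morph (fun u : sect (gr_sect G 1) => h (srepr u)) : u v / (u + v)%R}.
  by move=> u v; rewrite -[u]sreprK -[v]sreprK -sclassM // !hE hM.
by have [F FE] := tensorQ_lift hD; exists F => x; rewrite FE hE.
Qed.

Lemma gr_in_srepr n (u : sect (gr_sect G n)) : tensorQ_in u = gr_in n (srepr u).
Proof. by rewrite /gr_in sreprK. Qed.

Lemma gr_inM n x y : gamma G n x -> gamma G n y ->
  gr_in n (x * y) = (gr_in n x + gr_in n y)%R.
Proof. by move=> Gx Gy; rewrite /gr_in sclassM // tensorQ_inD. Qed.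

Lemma gr_inV n x : gamma G n x -> gr_in n x^-1 = (- gr_in n x)%R.
Proof.
move=> Gx; apply/eqP; rewrite -addr_eq0 -gr_inM ?mulVg //; last exact: sgV.
by apply/eqP; exact: raddf0.
Qed.

Lemma gr_in0 n x : gamma G n.+1 x -> gr_in n x = 0%R.
Proof.
move=> Gx; have /(sclass0P (S := gr_sect G n) (gamma_sub Gx)) E := Gx.
by rewrite /gr_in E; exact: raddf0.
Qed.

Lemma gr_inJ n x g : gamma G n x -> gr_in n (x ^ g) = gr_in n x.
Proof.
move=> Gx; have Gxg : gamma G n.+1 [~ x, g].
  by rewrite -invgR; apply: (sgV (gs _)); apply: gamma_commT.
rewrite conj_commg gr_inM //; last exact: gamma_sub.
by rewrite [X in (_ + X)%R]gr_in0 ?addr0.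
Qed.

Lemma gr_in_comml n x : gamma G n x ->
  {morph (fun g => gr_in n.+1 [~ g, x]) : g g' / g * g' >-> (g + g')%R}.
Proof.
move=> Gx g g'; have C h := gamma_commT h Gx.
by rewrite commMg gr_inM ?gr_inJ //; apply: gamma_conj.
Qed.

Lemma gr_in_commr_map n g : exists F : {linear T n -> T n.+1},
  forall x, gamma G n x -> F (gr_in n x) = gr_in n.+1 [~ g, x].
Proof.
pose h (x : G) : T n.+1 := gr_in n.+1 [~ g, x].
have C x : gamma G n x -> gamma G n.+1 [~ g, x] by exact: gamma_commT.
have hM x y : gamma G n x -> gamma G n y -> h (x * y) = (h x + h y)%R.
  move=> Gx Gy; have Cx := C x Gx; have Cy := C y Gy.
  rewrite /h commgM (gr_inM Cy (gamma_conj y Cx)) (gr_inJ y Cx).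
  exact: addrC.
have hE x : gamma G n x -> h (srepr (sclass (gr_sect G n) x)) = h x.
  move=> Gx; have D := srepr_class (S := gr_sect G n) Gx.
  rewrite -[srepr _](mulgVK x) hM //; last exact: gamma_sub.
  by rewrite [h _]gr_in0 ?add0r //; apply: gamma_commT.
have hD : {morph (fun u : sect (gr_sect G n) => h (srepr u)) : u v / (u + v)%R}.
  move=> u v; rewrite -[u]sreprK -[v]sreprK.
  have [Nu Nv] := (srepr_numer u, srepr_numer v).
  rewrite -sclassM // !hE ?hM //; exact: (sgM (gs n)).
by have [F FE] := tensorQ_lift hD; exists F => x Gx; rewrite FE hE.
Qed.

(** Brackets are additive in each argument; expanding x over t for fixed g, and g
    over s for fixed v in t, reduces every bracket [g, x] to the listed ones. *)
Lemma gr_fin_span_step n :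
  fin_span (T 1) -> fin_span (T n.+1) -> fin_span (T n.+2).
Proof.
move=> /tensorQ_fin_span[s sV] /tensorQ_fin_span[t tV].
pose r := [seq sclass (gr_sect G n.+2) [~ srepr u, srepr v] | u <- s, v <- t].
pose W : set (T n.+2) := @lspan rat (T n.+2) (@tensorQ_in _ @` [set` r]).
suff WT y : gamma G n.+2 y -> W (gr_in n.+2 y).
  apply: (@fin_span_tensorQ _ r) => w; rewrite gr_in_srepr.
  by apply: WT; exact: (srepr_numer w).
have WB u v : W u -> W v -> W (u - v)%R.
  by move=> Wu Wv; apply: lspanD => //; apply: lspanN.
have W1 g v : v \in t -> W (gr_in n.+2 [~ g, srepr v]).
  move=> tv; have Nv : gamma G n.+1 (srepr v) := srepr_numer v.
  have [F FE] := gr1_lift (gr_in_comml Nv).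
  rewrite -FE; apply: lspan_linear (sV _) => _ [u /= su <-].
  rewrite gr_in_srepr FE; apply: lspan_sub.
  exists (sclass (gr_sect G n.+2) [~ srepr u, srepr v]) => //.
  by apply/allpairsP; exists (u, v).
have W2 g x : gamma G n.+1 x -> W (gr_in n.+2 [~ g, x]).
  move=> Gx; have [F FE] := gr_in_commr_map n.+1 g.
  rewrite -FE //; apply: lspan_linear (tV _) => _ [v /= tv <-].
  by rewrite gr_in_srepr FE; [exact: W1|exact: (srepr_numer v)].
move=> Gy; suff: (gamma G n.+2 `&` [set y | W (gr_in n.+2 y)]) y by case.
move: y Gy; apply: generated_min.
  split; first split; first exact: (gs n.+2).1.
    by rewrite /mkset gr_in0; [exact: lspan0|exact: (gs n.+3).1].
  move=> x y [Gx Wx] [Gy Wy]; split; first exact: ((gs n.+2).2 _ _ Gx Gy).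
  rewrite /mkset (gr_inM Gx (sgV (gs _) Gy)) (gr_inV Gy).
  exact: (WB _ _ Wx Wy).
by move=> _ [g [x [_ Gx ->]]]; split; [exact: gamma_commT|exact: W2].
Qed.

Lemma gr_fin_span n : fin_span (T 1) -> fin_span (T n.+1).
Proof. by move=> T1; elim: n => [//|n IH]; apply: gr_fin_span_step. Qed.

(** Elements congruent modulo derivedQ1 G differ by torsion in gr_1, so they have
    the same class over the rationals. *)
Lemma gr1_fin_span_abf : fin_generated (abf G) -> fin_span (T 1).
Proof.
move=> [s sG]; pose r := [seq sclass (gr_sect G 1) (repr a) | a <- s].
pose W : set (T 1) := @lspan rat (T 1) (@tensorQ_in _ @` [set` r]).
suff WT g : W (gr_in 1 g).
  by apply: (@fin_span_tensorQ _ r) => w; rewrite gr_in_srepr; exact: WT.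
have WB u v : W u -> W v -> W (u - v)%R.
  by move=> Wu Wv; apply: lspanD => //; apply: lspanN.
have gr_in_abf x y : derivedQ1 G (x / y) -> gr_in 1 x = gr_in 1 y.
  move=> [m m0 Dxy]; apply/eqP; rewrite -subr_eq0 -gr_inV // -gr_inM //.
  apply/eqP/(tensorQ_in_torsion m0); rewrite -sclassX //.
  exact/(sclass0P (S := gr_sect G 1)).
have gr_in_repr x : gr_in 1 (repr (qclass (derivedQ1_normal G) x)) = gr_in 1 x.
  by apply: gr_in_abf; exact: (repr_qclass (derivedQ1_normal G) x).
rewrite -gr_in_repr; have : generated [set` s] (qclass (derivedQ1_normal G) g).
  by rewrite sG.
apply: (@generated_min _ _ [set a : abf G | W (gr_in 1 (repr a))]) => [|a sa].
  split.
    rewrite /mkset -[1]/(qclass (derivedQ1_normal G) 1) gr_in_repr.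
    by rewrite gr_in0; [exact: lspan0|exact: (gs 2).1].
  move=> a b Wa Wb; rewrite /mkset -[a]qclassK -[b]qclassK -gmulfF gr_in_repr.
  by rewrite gr_inM // gr_inV //; exact: (WB _ _ Wa Wb).
by apply: lspan_sub; exists (sclass (gr_sect G 1) (repr a)) => //; apply: map_f.
Qed.

End GradedGeneration.

(** The boundary relations say that the class map is additive, so H_1(G; Q) maps
    onto gr_1 over the rationals. *)
Lemma gr1_fin_span_H1Q (G : groupType) :
  fin_dimQ (H1Q G) -> fin_span (gr_tensorQ 1 G).
Proof.
have [L LE] := malg_lift (@gr_in G 1).
have L0 w : H1Q_boundary w -> L w = 0%R.
  move=> [x _ [y _ <-]]; rewrite linearD linearB /= !LE.
  by rewrite gr_inM // opprD addrCA subrr addr0 addNr.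
have [F FE] := quotv_lift L0.
move/fin_dimQ_span; apply: (fin_span_surj (f := F)) => w.
move: w (tensorQ_span w).
apply: lspan_ind => [|a u v [t <-] [t' <-]|_ [c _ <-]].
- by exists 0%R; rewrite linear0.
- by exists (a *: t + t')%R; rewrite linearP.
by exists (quotv_pi _ << srepr c >>%R); rewrite FE LE gr_in_srepr.
Qed.

Lemma metab_fin_dimQ (G : groupType) n :
  fin_span (gr_tensorQ 1 G) -> fin_dimQ (gr_tensorQ n.+1 (metab G)).
Proof.
move=> G1; apply/fin_span_dimQ/gr_fin_span.
apply: (gr_fin_span_surj (f := qclass (derived2_normal G))) G1 => u.
by exists (repr u); apply: qclassK.
Qed.

Theorem theorem1p3 (K G Q : groupType) (iota : groupHom K G) (p : groupHom G Q)
    (Hexact : abf_exact iota p)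
    (Qabelian : forall x y : Q, commute x y)
    (Qtorsion_free : torsion_free Q) :
  (exists f : {linear BQ K -> restrict (BQ G) (zgmap (abf_map iota))},
     (forall x : K, derivedQ1 K x -> f (BQ_class x) = BQ_class (iota x)) /\
     bijective f) /\
  (fin_generated (abf G) -> forall n : nat, (1 <= n)%N ->
     [/\ fin_dimQ (gr_tensorQ n (metab K)), fin_dimQ (gr_tensorQ n (metab G)) &
         (theta n K <= theta n G)%N]) /\
  ((exists s : groupHom Q G, forall q : Q, p (s q) = q) ->
     (exists F : forall n : nat, grQ K n -> grQ G n,
        grQ_induced 2 iota F /\ gl_iso_from 2 F) /\
     (exists F : forall n : nat, grQ (metab K) n -> grQ (metab G) n,
        grQ_induced 2 (metab_map iota) F /\ gl_iso_from 2 F) /\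
     (fin_dimQ (H1Q G) -> forall n : nat, (2 <= n)%N ->
        [/\ fin_dimQ (gr_tensorQ n K), fin_dimQ (gr_tensorQ n G) &
            phi n K = phi n G] /\
        [/\ fin_dimQ (gr_tensorQ n (metab K)), fin_dimQ (gr_tensorQ n (metab G)) &
            theta n K = theta n G])).
Proof.
have iota2 := abf_exact_gammaQ2 Hexact Qabelian Qtorsion_free.
have iota_ker := abf_exact_ker Hexact.
have metab2 := metab_gammaQ2 Hexact Qabelian Qtorsion_free.
have metab_ker := metab_ker Hexact Qabelian Qtorsion_free.
split; first exact: (BQ_iso Hexact Qabelian Qtorsion_free).
split.
  move=> /gr1_fin_span_abf G1 [|[|n]] // _.
    have fG := metab_fin_dimQ 0%N G1.
    by have [fK le] := gr1_tensorQ_dim metab2 metab_ker fG.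
  have fG := metab_fin_dimQ n.+1 G1.
  have [fK E] := gr_tensorQ_dim metab2 metab_ker fG.
  by split=> //; rewrite /theta /phi E.
move=> _; split; first exact: grQ_iso iota2 iota_ker.
split; first exact: grQ_iso metab2 metab_ker.
move=> /gr1_fin_span_H1Q G1 [|[|n]] // _.
have fG : fin_dimQ (gr_tensorQ n.+2 G) by apply/fin_span_dimQ/gr_fin_span.
have fM := metab_fin_dimQ n.+1 G1.
have [fK E] := gr_tensorQ_dim iota2 iota_ker fG.
have [fMK EM] := gr_tensorQ_dim metab2 metab_ker fM.
by split; split.
Qed.
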